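(* Let $\mu\in(0,1)$, let $p_1<p_2$ be real numbers, and let $u_0$ be a tempered distribution on $\mathbb{R}$ satisfying Condition $(C_{[p_1,p_2],\mu})$, with $\mathcal{F}u_0(p)=(p-p_1)^{\mu-1}\tilde u(p)$ on $(p_1,p_2)$. Let $u$ be the solution of the free Schrödinger equation with initial datum $u_0$. Let $\varepsilon>0$ with $p_1+\varepsilon<p_2$, and let $$\mathfrak{C}(p_1+\varepsilon,p_2):=\left\{(t,x)\in(0,+\infty)\times\mathbb{R}\;\middle|\;2(p_1+\varepsilon)<\tfrac xt<2p_2\right\}.$$ For $(t,x)\in\mathfrak{C}(p_1+\varepsilon,p_2)$ define $$H(t,x,u_0):=\frac1{2\sqrt\pi}e^{-i\frac\pi4}e^{i\frac{x^2}{4t}}\,\tilde u\!\left(\frac x{2t}\right)\left(\frac x{2t}-p_1\right)^{\mu-1},$$ $$K_\mu(t,x,u_0):=\frac{\Gamma(\mu)}{2^{\mu+1}\pi}e^{i\frac{\pi\mu}2}e^{-itp_1^2+ixp_1}\,\tilde u(p_1)\left(\frac x{2t}-p_1\right)^{-\mu}.$$ Let $\delta\in(\frac12,1)$. Then there exist constants $C^{(i)}_k(u_0,\varepsilon)\ge0$, depending only on $u_0,\varepsilon,\delta$, such that for all $(t,x)\in\mathfrak{C}(p_1+\varepsilon,p_2)$: (1) if $\mu>\frac12$, $$\left|u(t,x)-H(t,x,u_0)\,t^{-\frac12}\right|\le\sum_{k=1}^9C_k^{(1)}(u_0,\varepsilon)\,t^{-\tilde\beta_k^{(1)}},$$ where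 $(\tilde\beta_k^{(1)})_{k=1}^9=(\mu,1,1,2,\delta,\delta,\frac32,\delta,\delta)$, so $\max_k\{-\tilde\beta_k^{(1)}\}<-\frac12$; (2) if $\mu=\frac12$, $$\left|u(t,x)-\big(H(t,x,u_0)+K_\mu(t,x,u_0)\big)t^{-\frac12}\right|\le\sum_{k=1}^8C_k^{(2)}(u_0,\varepsilon)\,t^{-\tilde\beta_k^{(2)}},$$ where $(\tilde\beta_k^{(2)})_{k=1}^8=(1,1,2,\delta,\delta,\frac32,\delta,\delta)$, so $\max_k\{-\tilde\beta_k^{(2)}\}<-\frac12$; (3) if $\mu<\frac12$, $$\left|u(t,x)-K_\mu(t,x,u_0)\,t^{-\mu}\right|\le\sum_{k=1}^9C_k^{(3)}(u_0,\varepsilon)\,t^{-\tilde\beta_k^{(3)}},$$ where $(\tilde\beta_k^{(3)})_{k=1}^9=(\frac12,1,1,2,\delta,\delta,\frac32,\delta,\delta)$, so $\max_k\{-\tilde\beta_k^{(3)}\}<-\mu$.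
   Context: Fourier transform: $\mathcal{F}v(p)=\int_{\mathbb{R}}v(x)e^{-ixp}\,dx$, extended to tempered distributions. Condition $(C_{[p_1,p_2],\mu})$: $\mathcal{F}u_0$ is a function vanishing on $\mathbb{R}\setminus[p_1,p_2]$, and $\mathcal{F}u_0(p)=(p-p_1)^{\mu-1}\tilde u(p)$ for $p\in(p_1,p_2)$, where $\tilde u\in\mathcal{C}^1([p_1,p_2],\mathbb{C})$, $\tilde u(p_1)\ne0$ and $\tilde u(p_2)=0$ (i.e. $\mathcal{F}u_0(p_2)=0$). The solution of $[i\partial_t+\partial_x^2]u=0$, $u(0)=u_0$, is $u(t)=\mathcal{F}^{-1}(e^{-itp^2}\mathcal{F}u_0)$, that is, for $t>0$, $x\in\mathbb{R}$, $$u(t,x)=\frac1{2\pi}\int_{p_1}^{p_2}\mathcal{F}u_0(p)\,e^{-itp^2+ixp}\,dp .$$ *)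

(* Defs.v *)
From HB Require Import structures.
From mathcomp Require Import all_boot all_order all_algebra.
From mathcomp Require Import all_classical all_reals all_analysis.
From mathcomp Require Export complex.

Set Implicit Arguments.
Unset Strict Implicit.
Unset Printing Implicit Defensive.
Import Order.TTheory GRing.Theory Num.Theory.
Import numFieldNormedType.Exports.
Local Open Scope classical_set_scope.
Local Open Scope ring_scope.
Local Open Scope complex_scope.

(* Complex-valued functions of a real variable are integrated and
   differentiated through their real and imaginary parts. *)

Definition expi {R : realType} (a : R) : R[i] := cos a +i* sin a.

Definition cintegrable {R : realType} (D : set R) (f : R -> R[i]) : Prop :=
  (@lebesgue_measure R).-integrable D (fun x => (complex.Re (f x))%:E) /\
  (@lebesgue_measure R).-integrable D (fun x => (complex.Im (f x))%:E).

Definition cintegral {R : realType} (D : set R) (f : R -> R[i]) : R[i] :=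
  Rintegral (@lebesgue_measure R) D (fun x => complex.Re (f x)) +i*
  Rintegral (@lebesgue_measure R) D (fun x => complex.Im (f x)).

Definition cderivn {R : realType} (n : nat) (f : R -> R[i]) (x : R) : R[i] :=
  derive1n n (fun y => complex.Re (f y)) x +i* derive1n n (fun y => complex.Im (f y)) x.

Definition csmooth {R : realType} (f : R -> R[i]) : Prop :=
  forall (n : nat) (x : R),
    derivable (derive1n n (fun y => complex.Re (f y))) x 1 /\
    derivable (derive1n n (fun y => complex.Im (f y))) x 1.

(* The derivative is taken relative to [a, b], hence one-sided at a and b. *)
Definition C1_on {R : realType} (a b : R) (f : R -> R) : Prop :=
  exists2 f' : R -> R, {within `[a, b], continuous f'} &
    forall x : R, x \in `[a, b] ->
      (fun y : R => (y - x)^-1 * (f y - f x)) @ within `[a, b] x^' --> f' x.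

Definition cC1_on {R : realType} (a b : R) (f : R -> R[i]) : Prop :=
  C1_on a b (fun y => complex.Re (f y)) /\ C1_on a b (fun y => complex.Im (f y)).

Definition Gamma {R : realType} (s : R) : R :=
  Rintegral (@lebesgue_measure R) `]0, +oo[
    (fun x => x `^ (s - 1) * expR (- x)).

Definition schwartz {R : realType} (f : R -> R[i]) : Prop :=
  csmooth f /\
  forall k n : nat, exists M : R,
    forall x : R, `|x| ^+ k * Normc.normc (cderivn n f x) <= M.

Definition schwartz_seminorm {R : realType} (k n : nat) (f : R -> R[i]) : R :=
  sup (range (fun x : R => `|x| ^+ k * Normc.normc (cderivn n f x))).

(* A tempered distribution is represented by a functional on all functions,
   of which only the values at Schwartz functions are meaningful. *)
Record tempered_distribution (R : realType) := TemperedDistribution {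
  td_fun :> (R -> R[i]) -> R[i] ;
  td_linear : forall (a : R[i]) (f g : R -> R[i]), schwartz f -> schwartz g ->
    td_fun (fun x => a * f x + g x) = a * td_fun f + td_fun g ;
  td_continuous : exists (N : nat) (M : R), forall f : R -> R[i], schwartz f ->
    Normc.normc (td_fun f) <=
      M * \sum_(k < N.+1) \sum_(n < N.+1) schwartz_seminorm k n f }.

Definition fourier {R : realType} (v : R -> R[i]) (p : R) : R[i] :=
  cintegral setT (fun x => v x * expi (- (x * p))).

(* The extension of [fourier] by duality: <F T, f> = <T, F f>. *)
Definition td_fourier {R : realType} (T : tempered_distribution R)
  (f : R -> R[i]) : R[i] := T (fourier f).

(* The functional L is (integration against) the function g. *)
Definition is_function {R : realType} (L : (R -> R[i]) -> R[i])
    (g : R -> R[i]) : Prop :=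
  forall f : R -> R[i], schwartz f ->
    cintegrable setT (fun p => g p * f p) /\
    L f = cintegral setT (fun p => g p * f p).

(* Fu0 is the function F u_0 and ut is the regular factor \tilde u. *)
Record condition_C {R : realType} (p1 p2 mu : R) (u0 : tempered_distribution R)
    (Fu0 ut : R -> R[i]) : Prop := ConditionC {
  cC_fourier : is_function (td_fourier u0) Fu0 ;
  cC_support : forall p : R, p \notin `[p1, p2] -> Fu0 p = 0 ;
  cC_factor : forall p : R, p1 < p -> p < p2 ->
    Fu0 p = ((p - p1) `^ (mu - 1))%:C * ut p ;
  cC_regular : cC1_on p1 p2 ut ;
  cC_left : ut p1 != 0 ;
  cC_right : ut p2 = 0 }.

(* F^-1 (e^(-i t p^2) F u_0) at x, for F u_0 = Fu0 supported in [p1, p2]. *)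
Definition schrodinger_solution {R : realType} (p1 p2 : R) (Fu0 : R -> R[i])
    (t x : R) : R[i] :=
  ((2 * pi)^-1)%:C *
  cintegral `[p1, p2] (fun p => Fu0 p * expi (- (t * p ^+ 2) + x * p)).

Definition cone {R : realType} (a b : R) : set (R * R) :=
  [set tx | [/\ 0 < tx.1, 2 * a < tx.2 / tx.1 & tx.2 / tx.1 < 2 * b]].

Definition Hcoef {R : realType} (p1 mu : R) (ut : R -> R[i]) (t x : R) : R[i] :=
  ((2 * Num.sqrt pi)^-1)%:C * expi (- (pi / 4)) * expi (x ^+ 2 / (4 * t)) *
  ut (x / (2 * t)) * ((x / (2 * t) - p1) `^ (mu - 1))%:C.

Definition Kcoef {R : realType} (p1 mu : R) (ut : R -> R[i]) (t x : R) : R[i] :=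
  (Gamma mu / (2 `^ (mu + 1) * pi))%:C * expi (pi * mu / 2) *
  expi (- (t * p1 ^+ 2) + x * p1) * ut p1 *
  ((x / (2 * t) - p1) `^ (- mu))%:C.

Definition beta1 {R : realType} (mu delta : R) : 9.-tuple R :=
  [tuple mu; 1; 1; 2; delta; delta; 3 / 2; delta; delta].

Definition beta2 {R : realType} (delta : R) : 8.-tuple R :=
  [tuple 1; 1; 2; delta; delta; 3 / 2; delta; delta].

Definition beta3 {R : realType} (delta : R) : 9.-tuple R :=
  [tuple 1 / 2; 1; 1; 2; delta; delta; 3 / 2; delta; delta].

Definition max_neg {R : realType} (n : nat) (beta : n.+1.-tuple R) : R :=
  \big[Num.max/ - tnth beta ord0]_(k < n.+1) - tnth beta k.

Definition remainder {R : realType} (n : nat) (C : 'I_n -> R)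
    (beta : n.-tuple R) (t : R) : R :=
  \sum_(k < n) C k * t `^ (- tnth beta k).

(* Main.v *)
Require Import Defs.
From mathcomp Require Import all_boot all_order all_algebra.
From mathcomp Require Import all_classical all_reals all_analysis.
From mathcomp Require Import measurable_realfun ring lra.
Import Order.TTheory GRing.Theory Num.Theory.
Import numFieldNormedType.Exports.
Local Open Scope classical_set_scope.
Local Open Scope ring_scope.

(** Put s = p - p1, a = x/(2t) - p1, so that the phase is t (2 a s - s^2) up to
   a constant, and J(y) = \int_0^y s^(mu-1) e^{i t (2 a s - s^2)} ds.  As
   \tilde u (p2) = 0, integrating by parts against J gives
   2 pi u = - \int_0^(p2-p1) \tilde u'(p1 + y) J(y) dy up to a unimodular factor.
   Since J is close to the endpoint contribution k for y < a, and to k plus the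
   stationary contribution h for y > a, the right-hand side is
   k \tilde u(p1) + h \tilde u(x/(2t)) up to a multiple of
   \int |J - k - 1_(y > a) h|.  That integral is O(t^-1 + t^-delta): before
   a/2 the substitution sigma = s (2 a - s) reduces J to
   \int_0^. sigma^(mu-1) e^{i t sigma} d sigma, and near a the error is at most
   t^-delta |y - a|^(1 - 2 delta), by interpolation between t^(-1/2) and
   (t |y - a|)^-1.  The model integral
   \int_0^oo sigma^(mu-1) e^{i sigma} d sigma = Gamma(mu) e^{i pi mu / 2},
   with its O(A^(mu-1)) tail, comes from rotating the contour.
   An arbitrary phase shift [al] in real cosine integrals replaces complex
   integrals, and integrals of error terms are replaced by mean value estimates
   against explicit majorants. *)

(** * Mean value estimates and powers *)

Section calculus.
Context {R : realType}.
Implicit Types (f g B df dB : R -> R) (a b mu : R).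

(** [B - f] and [B + f] have nonnegative derivatives, hence do not decrease. This stands in for
    [|\int df| <= \int dB] without any integrability to check; as only one-sided limits are asked at
    [a] and [b], [dB] may blow up there, as [s^(mu - 1)] does at 0. *)
Lemma mean_value_majorant f df B dB a b : a <= b ->
  (forall x, a < x -> x < b -> is_derive x 1 f (df x)) ->
  (forall x, a < x -> x < b -> is_derive x 1 B (dB x)) ->
  (forall x, a < x -> x < b -> `|df x| <= dB x) ->
  f x @[x --> a^'+] --> f a -> f x @[x --> b^'-] --> f b ->
  B x @[x --> a^'+] --> B a -> B x @[x --> b^'-] --> B b ->
  `|f b - f a| <= B b - B a.
Proof.
move=> ab dfE dBE dfB fa fb Ba Bb.
have key g dg :
    (forall x, a < x -> x < b -> is_derive x 1 g (dg x)) ->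
    (forall x, a < x -> x < b -> `|dg x| <= dB x) ->
    g x @[x --> a^'+] --> g a -> g x @[x --> b^'-] --> g b ->
    g b - g a <= B b - B a.
  move=> dgE dgB ga gb.
  suff : (B - g) a <= (B - g) b.
    by rewrite -[(B - g) a]/(B a - g a) -[(B - g) b]/(B b - g b); lra.
  have dh x : x \in `]a, b[ -> is_derive x 1 (B - g) (dB x - dg x).
    rewrite in_itv/= => /andP[ax xb].
    by apply: is_deriveB; [exact: dBE|exact: dgE].
  apply: (@ger0_derive1_ndecr _ (B - g) a b) => //.
  - by move=> x /dh[].
  - move=> x xab; rewrite derive1E; have [_ ->] := dh _ xab.
    rewrite subr_ge0; move: xab; rewrite in_itv/= => /andP[ax xb].
    exact: le_trans (ler_norm _) (dgB _ ax xb).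
  - move: (ab); rewrite le_eqVlt => /predU1P[<-|_].
      by rewrite set_itv1; exact: continuous_subspace1.
    apply: derivable_oo_LRcontinuous_within; split; last 2 first.
    + exact: cvgB.
    + exact: cvgB.
    + by move=> x /dh[].
rewrite ler_norml; apply/andP; split; last exact: key dfE dfB fa fb.
suff : - f b - - f a <= B b - B a by lra.
apply: (key (- f) (fun x => - df x)).
- by move=> x ax xb; apply: is_deriveN; exact: dfE.
- by move=> x ax xb; rewrite normrN; exact: dfB.
- exact: cvgN.
- exact: cvgN.
Qed.

Lemma is_derive_powR_subl (p r y : R) : p < y ->
  is_derive y 1 (fun s => (s - p) `^ r) (r * (y - p) `^ (r - 1)).
Proof.
move=> py; have yp : 0 < y - p by rewrite subr_gt0.
rewrite -[X in is_derive _ _ _ X]mulr1.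
have h : is_derive y 1 (fun s : R => s - p) 1.
  by apply: is_derive_eq; rewrite subr0.
exact: (@is_derive1_comp _ (fun s => s `^ r) (fun s => s - p) y _ 1
  (is_derive1_powR r yp) h).
Qed.

Lemma is_derive_powR_subr (p r y : R) : y < p ->
  is_derive y 1 (fun s => (p - s) `^ r) (- (r * (p - y) `^ (r - 1))).
Proof.
move=> yp; have py : 0 < p - y by rewrite subr_gt0.
rewrite -[X in is_derive _ _ _ X]mulrN1.
have h : is_derive y 1 (fun s : R => p - s) (-1).
  by apply: is_derive_eq; rewrite add0r mul1r.
exact: (@is_derive1_comp _ (fun s => s `^ r) (fun s => p - s) y _ (-1)
  (is_derive1_powR r py) h).
Qed.

Lemma cvg_powR_subl (p r : R) : 0 < r ->
  (s - p) `^ r @[s --> p^'+] --> (p - p) `^ r.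
Proof.
move=> r0; rewrite subrr powR0 ?gt_eqF//.
apply: (@increasing_cvg_at_right_comp _ (fun s => s - p) (fun s => s `^ r) p +oo%O) => //.
- by move=> x y _ _ xy /=; rewrite ltrD2r.
- by apply: cvg_at_right_filter; apply: cvgB; [exact: cvg_id|exact: cvg_cst].
- by rewrite subrr; exact: powR_cvg0.
Qed.

Lemma cvg_powR_subr (p r : R) : 0 < r ->
  (p - s) `^ r @[s --> p^'-] --> (p - p) `^ r.
Proof.
move=> r0; rewrite subrr powR0 ?gt_eqF//.
apply: (@decreasing_cvg_at_left_comp _ (fun s => p - s) (fun s => s `^ r) -oo%O p) => //.
- by move=> x y _ _ xy /=; rewrite ltrD2l ltrN2.
- by apply: cvg_at_left_filter; apply: cvgB; [exact: cvg_cst|exact: cvg_id].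
- by rewrite subrr; exact: powR_cvg0.
Qed.

Lemma is_derive_continuous f (df x : R) : is_derive x 1 f df -> {for x, continuous f}.
Proof. by case=> /derivable1_diffP /differentiable_continuous. Qed.

Lemma continuous_powR_subl (p r y : R) : p < y -> {for y, continuous (fun s => (s - p) `^ r)}.
Proof. by move=> py; exact: is_derive_continuous (is_derive_powR_subl p r y py). Qed.

End calculus.

(** * Integrals with an algebraic singularity at the left endpoint *)

Section weighted_integrals.
Context {R : realType}.
Notation lebesgue := (@lebesgue_measure R).
Implicit Types (c : R -> R) (p q mu : R).

(** Monotone convergence: the segments [F n] increase to []p, q]], and on each of them the primitive
    [(s - p)^mu / mu] bounds the integral by [(q - p)^mu / mu]. *)
Lemma integrable_weight p q mu : 0 < mu ->
  lebesgue.-integrable `[p, q] (EFin \o (fun s => (s - p) `^ (mu - 1))).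
Proof.
move=> mu0; pose w s : R := (s - p) `^ (mu - 1).
have mw D : measurable_fun D w.
  apply: measurable_funTS; apply: (measurableT_comp (measurable_powR _)).
  by apply: measurable_funB.
have [qp|pq] := ltP q p.
  by rewrite set_itv_ge -?ltNge//; exact: integrable_set0.
pose F n := `[p + (q - p) / n.+1%:R, q]%classic.
have Flt n x : F n x -> p < q -> p < x.
  rewrite /F/= in_itv/= => /andP[Fx _] pltq; apply: lt_le_trans Fx.
  by rewrite ltrDl divr_gt0// subr_gt0.
have intF n : (\int[lebesgue]_(x in F n) (w x)%:E <= ((q - p) `^ mu / mu)%:E)%E.
  move: (pq); rewrite le_eqVlt => /predU1P[pE|pltq].
    rewrite /F pE subrr mul0r addr0 set_itv1 integral_set1.
    by rewrite lee_fin divr_ge0// ?powR_ge0// ltW.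
  have := pltq; rewrite -subr_gt0 => qp0.
  (* For [n = 0] the left end [p + (q - p) / 1] is [q]: the segment is a single point. *)
  case: n => [|n].
    rewrite /F divr1 addrC subrK set_itv1 integral_set1.
    by rewrite lee_fin divr_ge0// ?powR_ge0// ltW.
  have pr : p < p + (q - p) / n.+2%:R by rewrite ltrDl divr_gt0.
  have rq : p + (q - p) / n.+2%:R < q.
    by rewrite -ltrBrDl ltr_pdivrMr// ltr_pMr// ltr1n.
  have dW (x : R) : p < x -> is_derive x 1 (mu^-1 *: (fun s : R => (s - p) `^ mu)) (w x).
    move=> px; have := is_derive_powR_subl p mu x px => dx.
    by apply: is_derive_eq; rewrite scalerA mulVf ?gt_eqF// scale1r.
  rewrite /F (@continuous_FTC2 _ _ (mu^-1 *: (fun s => (s - p) `^ mu)))//.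
  - rewrite -EFinB lee_fin -[leLHS]/(mu^-1 * _ - mu^-1 * _).
    rewrite mulrC lerBlDr lerDl mulr_ge0// ?powR_ge0// invr_ge0 ltW//.
  - apply: continuous_in_subspaceT => x; rewrite inE/= in_itv/= => /andP[rx _].
    by apply: continuous_powR_subl; exact: lt_le_trans rx.
  - split.
    + move=> x; rewrite in_itv/= => /andP[rx _].
      by have [] := dW _ (lt_trans pr rx).
    + apply: cvg_at_right_filter; exact: is_derive_continuous (dW _ pr).
    + apply: cvg_at_left_filter; exact: is_derive_continuous (dW _ pltq).
  - move=> x; rewrite in_itv/= => /andP[rx _]; rewrite derive1E.
    by have [_ ->] := dW _ (lt_trans pr rx).
have bF : \bigcup_n F n = `]p, q]%classic \/ p = q.
  move: (pq); rewrite le_eqVlt => /predU1P[|pltq]; [by right|left].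
  apply/seteqP; split => x.
    move=> [n _ Fx]; have := Flt n x Fx pltq.
    by move: Fx; rewrite /F/= !in_itv/= => /andP[_ ->] ->.
  rewrite /= in_itv/= => /andP[px xq].
  have xp : 0 < x - p by rewrite subr_gt0.
  (* Any [n] with [(q - p) / (x - p) <= n + 1] puts [x] in [F n]. *)
  exists (Num.truncn ((q - p) / (x - p))) => //.
  rewrite /F/= in_itv/= xq andbT -lerBrDl ler_pdivrMr// mulrC -ler_pdivrMr//.
  by apply: ltW; rewrite truncnS_gt.
move: bF => [bF|pE]; last first.
  rewrite -pE set_itv1; apply: null_set_integrable => //.
    by apply/measurable_EFinP; exact: mw.
  exact: lebesgue_measure_set1.
apply/integrableP; split; first by apply/measurable_EFinP; exact: mw.
rewrite -integral_itv_obnd_cbnd; last first.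
  by apply: measurableT_comp => //; apply/measurable_EFinP; exact: mw.
rewrite -bF.
have cvgF := @ge0_nondecreasing_set_cvg_integral _ (measurableTypeR R) R F
  (fun x => `|(w x)%:E|%E) lebesgue.
have ndF : nondecreasing_seq F.
  apply/nondecreasing_seqP => n; apply/subsetPset => x.
  rewrite /F/= !in_itv/= => /andP[Fx ->]; rewrite andbT; apply: le_trans Fx.
  by rewrite lerD2l ler_wpM2l ?subr_ge0// lef_pV2 ?posrE// ler_nat.
have mF i : measurable (F i) by exact: measurable_itv.
have mwF i : measurable_fun (F i) (fun x => `|(w x)%:E|%E).
  by apply: measurableT_comp => //; apply/measurable_EFinP; exact: mw.
have {cvgF}cvgF := cvgF ndF mF mwF (fun _ _ _ => abse_ge0 _).
apply: (@le_lt_trans _ _ ((q - p) `^ mu / mu)%:E); last by rewrite ltry.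
rewrite /comp -(cvg_lim _ cvgF)//.
apply: lime_le; first by apply/cvg_ex; eexists; exact: cvgF.
apply: nearW => n; apply: le_trans (intF n).
rewrite le_eqVlt; apply/orP; left; apply/eqP.
by apply: eq_integral => x _; rewrite gee0_abs// lee_fin powR_ge0.
Qed.

Lemma integrable_weighted c p q mu : 0 < mu -> continuous c ->
  lebesgue.-integrable `[p, q] (EFin \o (fun s => (s - p) `^ (mu - 1) * c s)).
Proof.
move=> mu0 cc.
have cc' : {within `[p, q], continuous c} by exact: continuous_subspaceT.
have := @integrableMl _ _ _ lebesgue `[p, q]%classic _
  (EFin \o (fun s : R => (s - p) `^ (mu - 1))) c (integrable_weight p q mu mu0).
apply => //.
- by apply: measurable_funTS; exact: continuous_measurable_fun.
- have /compact_bounded := continuous_compact cc' (@segment_compact _ p q).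
  move=> [M [Mreal Mb]]; exists M; split => // x Mx y py /=.
  by apply: Mb Mx _ _; exists y.
Qed.

(** Left of [p] the segment is empty and the value is 0, so for [mu > 0] and continuous [c] this is
    continuous on the whole line. *)
Definition weighted_primitive c p mu (y : R) : R :=
  Rintegral lebesgue `[p, y] (fun s => (s - p) `^ (mu - 1) * c s).

Lemma weighted_primitive_eq0 c p mu y : y <= p -> weighted_primitive c p mu y = 0.
Proof.
rewrite /weighted_primitive le_eqVlt => /predU1P[->|yp].
  by rewrite set_itv1 Rintegral_set1.
by rewrite set_itv_ge -?ltNge// Rintegral_set0.
Qed.

Lemma is_derive_weighted_primitive c p mu y : 0 < mu -> continuous c -> p < y ->
  is_derive y 1 (weighted_primitive c p mu) ((y - p) `^ (mu - 1) * c y).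
Proof.
move=> mu0 cc py.
(* The right end [y + 1] makes [y] an interior point. *)
have [|||| dX dXE] := @continuous_FTC1_closed R
  (fun s => (s - p) `^ (mu - 1) * c s) p y (y + 1).
- by rewrite ltrDl.
- exact: integrable_weighted.
- exact: py.
- by apply: cvgM; [exact: continuous_powR_subl|exact: cc].
- by apply: (DeriveDef dX); rewrite -derive1E; exact: dXE.
Qed.

Lemma continuous_weighted_primitive c p mu : 0 < mu -> continuous c ->
  continuous (weighted_primitive c p mu).
Proof.
move=> mu0 cc y; have [yp|py|<-] := ltgtP y p.
- rewrite /continuous_at weighted_primitive_eq0 ?ltW//.
  apply: cvg_near_cst; near=> z; rewrite weighted_primitive_eq0//.
  by apply: ltW; near: z; exact: lt_nbhsl.
- exact: is_derive_continuous (is_derive_weighted_primitive _ _ _ _ mu0 cc py).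
- rewrite /continuous_at weighted_primitive_eq0//.
  have y1 : y < y + 1 by rewrite ltrDl.
  have := parameterized_integral_cvg_left y1 (integrable_weighted c y (y + 1) mu mu0 cc).
  by [].
Unshelve. all: by end_near. Qed.

End weighted_integrals.

(** * Rotation of the contour *)

Section derivation_rules.
Context {R : realType}.
Implicit Types (f g : R -> R) (x df dg k : R).

Lemma is_derive1D f g x df dg : is_derive x 1 f df -> is_derive x 1 g dg ->
  is_derive x 1 (fun y => f y + g y) (df + dg).
Proof. by move=> ? ?; exact: is_deriveD. Qed.

Lemma is_derive1B f g x df dg : is_derive x 1 f df -> is_derive x 1 g dg ->
  is_derive x 1 (fun y => f y - g y) (df - dg).
Proof. by move=> ? ?; exact: is_deriveB. Qed.

Lemma is_derive1N f x df : is_derive x 1 f df ->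
  is_derive x 1 (fun y => - f y) (- df).
Proof. by move=> ?; exact: is_deriveN. Qed.

Lemma is_derive1M f g x df dg : is_derive x 1 f df -> is_derive x 1 g dg ->
  is_derive x 1 (fun y => f y * g y) (df * g x + f x * dg).
Proof.
move=> Df Dg; apply: (is_derive_eq (is_deriveM Df Dg)).
by rewrite /GRing.scale/= addrC mulrC.
Qed.

Lemma is_derive1_id x : is_derive x 1 (fun y => y) 1.
Proof. exact: is_derive_id. Qed.

Lemma is_derive1_cst k x : is_derive x 1 (fun=> k) 0.
Proof. exact: is_derive_cst. Qed.

Lemma is_derive1_expR_comp g x dg : is_derive x 1 g dg ->
  is_derive x 1 (fun y => expR (g y)) (expR (g x) * dg).
Proof. by move=> Dg; exact: (is_derive1_comp (is_derive_expR (g x)) Dg). Qed.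

Lemma is_derive1_cos_comp g x dg : is_derive x 1 g dg ->
  is_derive x 1 (fun y => cos (g y)) (- sin (g x) * dg).
Proof. by move=> Dg; exact: (is_derive1_comp (is_derive_cos (g x)) Dg). Qed.

Lemma is_derive1_sin_comp g x dg : is_derive x 1 g dg ->
  is_derive x 1 (fun y => sin (g y)) (cos (g x) * dg).
Proof. by move=> Dg; exact: (is_derive1_comp (is_derive_sin (g x)) Dg). Qed.

End derivation_rules.

(** The derivative is left as an existential variable, to be compared afterwards with the wanted
    one. Hypotheses are tried first: the derivatives of powers and primitives come from the
    context. *)
Ltac derive_rules := repeat first
  [ eassumption
  | refine (is_derive1_id _)
  | refine (is_derive1_cst _ _)
  | eapply is_derive1B | eapply is_derive1D | eapply is_derive1N
  | eapply is_derive1M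
  | eapply is_derive1_expR_comp | eapply is_derive1_cos_comp
  | eapply is_derive1_sin_comp ].

(** * Cauchy's theorem on a circular sector, in real form *)

Section rotation.
Context {R : realType}.
Implicit Types (mu al A th s : R).
Notation lebesgue := (@lebesgue_measure R).

(** [s^(mu - 1) * kernel mu al th s] is the real part of [e^(i al) z^(mu - 1) e^(-z) dz/ds] along
    the ray [z = s e^(-i th)]. The ray [th = 0] carries the Gamma integral, the ray [th = pi / 2]
    the oscillatory one. *)
Let kernel mu al th s : R :=
  expR (- (s * cos th)) * cos (s * sin th - mu * th + al).

Let dkernel mu al th s : R :=
  expR (- (s * cos th)) *
    (s * sin th * cos (s * sin th - mu * th + al)
     - (s * cos th - mu) * sin (s * sin th - mu * th + al)).

Let continuous_kernel mu al th : continuous (kernel mu al th).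
Proof. by move=> s; eapply is_derive_continuous; rewrite /kernel; derive_rules. Qed.

Let continuous_dkernel mu al th : continuous (dkernel mu al th).
Proof. by move=> s; eapply is_derive_continuous; rewrite /dkernel; derive_rules. Qed.

Let is_derive_kernel mu al th s :
  is_derive th 1 (fun u => kernel mu al u s) (dkernel mu al th s).
Proof.
eapply is_derive_eq; first by rewrite /kernel; derive_rules.
by rewrite /dkernel; ring.
Qed.

(** The real part of [e^(i al) z^(mu - 1) e^(-z) dz/dth] along the arc [z = s e^(-i th)] of radius
    [s]. *)
Let boundary mu al th s : R :=
  s `^ mu * expR (- (s * cos th)) * sin (s * sin th - mu * th + al).

(* [boundary] is an exact primitive in [s] of the [th]-derivative of the
   rotated integrand; this is Cauchy's theorem on the circular sector. *)
Let integral_dkernel mu al th A : 0 < mu -> 0 < A ->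
  weighted_primitive (dkernel mu al th) 0 mu A = boundary mu al th A.
Proof.
move=> mu0 A0; pose Y := weighted_primitive (dkernel mu al th) 0 mu.
pose f s := Y s - boundary mu al th s.
have boundaryE : boundary mu al th = fun s => (s - 0) `^ mu * (expR (- (s * cos th)) * sin (s * sin th - mu * th + al)).
  by apply/funext => s; rewrite /boundary subr0 mulrA.
have cY : continuous Y by exact: continuous_weighted_primitive.
have ce : continuous (fun s : R => expR (- (s * cos th)) * sin (s * sin th - mu * th + al)).
  by move=> s; eapply is_derive_continuous; derive_rules.
have dE s : 0 < s -> is_derive s 1 f 0.
  move=> s0; have dY : is_derive s 1 Y _ := is_derive_weighted_primitive _ 0 _ _ mu0 (continuous_dkernel mu al th) s0.
  have dp := is_derive_powR_subl 0 mu s s0.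
  eapply is_derive_eq; first by rewrite /f boundaryE; derive_rules.
  have -> : (s - 0) `^ mu = s * (s - 0) `^ (mu - 1) by rewrite subr0 mulr_powRB1// ltW.
  by rewrite /dkernel; ring.
(* [f] is constant on [[0, A]]: its derivative vanishes for [s > 0] and it is right-continuous at 0,
   so the zero majorant applies. *)
have : `|f A - f 0| <= 0 - 0.
  apply: (@mean_value_majorant _ f (cst 0) (cst 0) (cst 0) 0 A) => //.
  - exact: ltW.
  - by move=> s s0 _; exact: dE.
  - by move=> s s0 _; rewrite normr0.
  - rewrite /f boundaryE; apply: cvgB; first by apply: cvg_at_right_filter; exact: cY.
    apply: cvgM; first exact: cvg_powR_subl.
    by apply: cvg_at_right_filter; exact: ce.
  - by apply: cvg_at_left_filter; exact: is_derive_continuous (dE _ A0).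
  - exact: cvg_cst.
  - exact: cvg_cst.
rewrite subrr normr_le0 subr_eq0 => /eqP.
rewrite {2}/f /boundary powR0 ?gt_eqF// !mul0r subr0 /Y weighted_primitive_eq0//.
by move/eqP; rewrite subr_eq0 => /eqP.
Qed.

Let rotated mu al A th := weighted_primitive (kernel mu al th) 0 mu A.

(** Differentiation under the integral sign, then [integral_dkernel]: when the ray turns, only the
    arc of radius [A] contributes. *)
Let is_derive_rotated mu al A th : 0 < mu -> 0 < A ->
  is_derive th 1 (rotated mu al A) (boundary mu al th A).
Proof.
move=> mu0 A0.
pose f (u s : R) := (s - 0) `^ (mu - 1) * kernel mu al u s.
have d1f u s : partial1of2 f u s = (s - 0) `^ (mu - 1) * dkernel mu al u s.
  rewrite partial1of2E.
  have : is_derive u 1 (f ^~ s) ((s - 0) `^ (mu - 1) * dkernel mu al u s).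
    have := is_derive_kernel mu al u s => dk.
    eapply is_derive_eq; first by rewrite /f; derive_rules.
    by rewrite mul0r add0r.
  by case.
(* For [0 <= s <= A] the exponential is at most [e^A], [|s sin th|] at most [A] and
   [|s cos th - mu|] at most [A + mu]: a domination uniform in the angle. *)
pose M : R := expR A * (A + (A + mu)).
pose G s : R := `|(s - 0) `^ (mu - 1) * M|.
have thI : `]th - 1, th + 1[%classic th by rewrite /= in_itv/= ltrBlDr !ltrDl ltr01.
have intf u : `]th - 1, th + 1[%classic u -> lebesgue.-integrable `[0, A] (EFin \o f u).
  by move=> _; apply: integrable_weighted => //; exact: continuous_kernel.
have derf u s : `]th - 1, th + 1[%classic u -> `[0, A]%classic s -> derivable (f ^~ s) u 1.
  move=> _ _; have := is_derive_kernel mu al u s => dk.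
  eapply ex_derive; rewrite /f; derive_rules.
have G0 s : 0 <= G s by exact: normr_ge0.
have intG : lebesgue.-integrable `[0, A] (EFin \o G).
  have : lebesgue.-integrable `[0, A] (EFin \o (fun s : R => (s - 0) `^ (mu - 1) * M)).
    by apply: integrable_weighted => // s; exact: cst_continuous.
  exact: integrable_norm.
have Gub u s : `]th - 1, th + 1[%classic u -> `[0, A]%classic s -> `|partial1of2 f u s| <= G s.
  rewrite /= !in_itv/= => _ /andP[s0 sA]; rewrite d1f /G normrM [leRHS]normrM ler_wpM2l//.
  have cos1 v : `|cos v : R| <= 1 by rewrite ler_norml cos_geN1 cos_le1.
  have sin1 v : `|sin v : R| <= 1 by rewrite ler_norml sin_geN1 sin_le1.
  rewrite /dkernel normrM (ger0_norm (expR_ge0 _)) [leRHS]ger0_norm; last first.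
    by rewrite mulr_ge0 ?expR_ge0// !addr_ge0// ltW.
  apply: ler_pM => //.
    rewrite ler_expR; apply: le_trans sA.
    rewrite -mulrN ler_piMr// lerNl; exact: cos_geN1.
  apply: (le_trans (ler_normB _ _)); apply: lerD.
    rewrite !normrM (ger0_norm s0) -[leRHS]mulr1 -[A]mulr1.
    by rewrite ler_pM// ?mulr_ge0// ler_pM.
  rewrite normrM -[leRHS]mulr1 ler_pM// (le_trans (ler_normB _ _))//.
  rewrite lerD// ?(gtr0_norm mu0)// normrM (ger0_norm s0) -[A]mulr1.
  by rewrite ler_pM.
have mA : measurable (`[0, A]%classic : set (measurableTypeR R)) by exact: measurable_itv.
have dF := @derivable_under_integral R _ (measurableTypeR R) lebesgue f _ mA
  th (th - 1) (th + 1) thI intf derf G G0 intG Gub.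
have FE := @differentiation_under_integral R _ (measurableTypeR R) lebesgue f _ mA
  th (th - 1) (th + 1) thI intf derf G G0 intG Gub.
apply: (DeriveDef dF); rewrite -derive1E FE -integral_dkernel//.
by apply: eq_Rintegral => s _; rewrite -d1f.
Qed.

(** With the shift [pi * mu / 2 + al], the two terms are [rotated] at the angles [pi / 2] and 0, so
    their difference is the contribution of the quarter arc of radius [A]. *)
Lemma jordan_bound mu al A : 0 < mu -> 0 < A ->
  `|weighted_primitive (fun s => cos (s + al)) 0 mu A -
    cos (pi * mu / 2 + al) * weighted_primitive (fun s => expR (- s)) 0 mu A|
  <= (1 + pi / 2) * A `^ (mu - 1).
Proof.
move=> mu0 A0.
pose al' := pi * mu / 2 + al.
have -> : weighted_primitive (fun s => cos (s + al)) 0 mu A = rotated mu al' A (pi / 2).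
  congr (weighted_primitive _ _ _ _); apply/funext => s.
  rewrite /kernel cos_pihalf sin_pihalf mulr0 oppr0 expR0 mul1r mulr1.
  by congr cos; rewrite /al'; lra.
have -> : cos (pi * mu / 2 + al) * weighted_primitive (fun s => expR (- s)) 0 mu A =
   rotated mu al' A 0.
  rewrite /rotated /weighted_primitive -RintegralZl//; last first.
    apply: integrable_weighted => // s; eapply is_derive_continuous; derive_rules.
  apply: eq_Rintegral => s _; rewrite /kernel cos0 sin0 mulr1 !mulr0 subrr add0r.
  by rewrite -/al'; ring.
(* On the quarter arc [A e^(-A cos th) <= A sin th e^(-A cos th) + 1], because
   [sin th + cos th >= 1] and [v e^(-v) <= 1]; unlike the left-hand side, the right-hand side has an
   explicit primitive. *)
pose B th : R := A `^ mu * A^-1 * (expR (- (A * cos th)) + th).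
pose dB th : R := A `^ mu * A^-1 * (expR (- (A * cos th)) * (A * sin th) + 1).
have dBE th : is_derive th 1 B (dB th).
  by eapply is_derive_eq; [rewrite /B; derive_rules|rewrite /dB; ring].
apply: (@le_trans _ _ (B (pi / 2) - B 0)).
  apply: (@mean_value_majorant _ (rotated mu al' A) (fun th => boundary mu al' th A) B dB) => //.
  - by rewrite divr_ge0// pi_ge0.
  - by move=> th _ _; exact: is_derive_rotated.
  - move=> th th0 thpi.
    have s0 : 0 <= sin th by apply: sin_ge0_pi; rewrite ltW//=; have := pi_gt0 R; lra.
    have c0 : 0 <= cos th.
      by apply: cos_ge0_pihalf; rewrite (ltW thpi) andbT; have := pi_gt0 R; lra.
    have sc : 1 <= sin th + cos th.
      have := cos2Dsin2 th; have := sin_le1 th; have := cos_le1 th; nra.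
    rewrite /boundary normrM ger0_norm ?mulr_ge0 ?powR_ge0 ?expR_ge0//.
    apply: (@le_trans _ _ (A `^ mu * expR (- (A * cos th)))).
      rewrite ler_piMr// ?mulr_ge0 ?powR_ge0 ?expR_ge0//.
      by rewrite ler_norml sin_geN1 sin_le1.
    rewrite /dB -mulrA ler_wpM2l ?powR_ge0// [leRHS]mulrC ler_pdivlMr//.
    have h : expR (- (A * cos th)) * (A * cos th) <= 1.
      rewrite expRN mulrC ler_pdivrMr ?expR_gt0// mul1r.
      by have := expR_ge1Dx (A * cos th); lra.
    have := expR_ge0 (- (A * cos th)); move: h.
    move: (expR (- (A * cos th))) => e h e0.
    have : 0 <= e * A * (sin th + cos th - 1) by rewrite !mulr_ge0// ?(ltW A0)// subr_ge0.
    by lra.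
  - by apply: cvg_at_right_filter; exact: is_derive_continuous (is_derive_rotated _ _ _ _ mu0 A0).
  - by apply: cvg_at_left_filter; exact: is_derive_continuous (is_derive_rotated _ _ _ _ mu0 A0).
  - by apply: cvg_at_right_filter; exact: is_derive_continuous (dBE _).
  - by apply: cvg_at_left_filter; exact: is_derive_continuous (dBE _).
rewrite /B cos_pihalf cos0 mulr0 mulr1 oppr0 expR0 addr0.
have -> : A `^ (mu - 1) = A `^ mu * A^-1.
  rewrite powRB; last by rewrite (gt_eqF A0) implybT.
  by rewrite powRr1// ltW.
have : 0 <= A `^ mu * A^-1 * expR (- A).
  by rewrite !mulr_ge0 ?powR_ge0 ?expR_ge0// invr_ge0 ltW.
by lra.
Qed.

End rotation.

(** * Tails of the model integral *)

Section gamma_tail.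
Context {R : realType}.
Notation lebesgue := (@lebesgue_measure R).
Implicit Types (mu al A k s : R).

Let cexpN : continuous (fun s : R => expR (- s)).
Proof. by move=> s; eapply is_derive_continuous; derive_rules. Qed.

Let ccos al : continuous (fun s : R => cos (s + al)).
Proof. by move=> s; eapply is_derive_continuous; derive_rules. Qed.

Lemma Gamma_ge0 mu : 0 <= Gamma mu :> R.
Proof. by apply: Rintegral_ge0 => x _; rewrite mulr_ge0 ?powR_ge0 ?expR_ge0. Qed.

(** Beyond [A] the weight is at most [A^(mu - 1)], as [mu <= 1], and [e^(-s)] has integral at most
    1. *)
Lemma Gamma_tail mu A : 0 < mu -> mu <= 1 -> 0 < A ->
  `|weighted_primitive (fun s => expR (- s)) 0 mu A - Gamma mu| <= A `^ (mu - 1).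
Proof.
move=> mu0 mu1 A0; pose w s : R := s `^ (mu - 1) * expR (- s).
have mw D : measurable_fun D w.
  apply: measurable_funTS; apply: measurable_funM; first exact: measurable_powR.
  exact: continuous_measurable_fun.
have w0 s : (0 <= (w s)%:E)%E by rewrite lee_fin mulr_ge0 ?powR_ge0 ?expR_ge0.
have mwE D : measurable_fun D (fun s => (w s)%:E) by apply/measurable_EFinP; exact: mw.
have intw : lebesgue.-integrable `[0, A] (fun s => (w s)%:E).
  apply: eq_integrable (integrable_weighted (fun s => expR (- s)) 0 A mu mu0 cexpN) => //.
  by move=> s _; rewrite /= subr0.
have wpE : (\int[lebesgue]_(s in `]0%R, A]) (w s)%:E =
    (weighted_primitive (fun s => expR (- s)) 0 mu A)%:E)%E.
  rewrite integral_itv_obnd_cbnd; last exact: mwE.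
  have <- : Rintegral lebesgue `[0, A] w = weighted_primitive (fun s => expR (- s)) 0 mu A.
    by apply: eq_Rintegral => s _; rewrite subr0.
  by apply/esym/fineK/(integrable_fin_num _ intw).
have tail_le : (\int[lebesgue]_(s in `]A, +oo[) (w s)%:E <= (A `^ (mu - 1))%:E)%E.
  pose e s : R := A `^ (mu - 1) * expR (- s).
  have ce : continuous e by move=> s; eapply is_derive_continuous; rewrite /e; derive_rules.
  have dF s : is_derive s 1 (fun s => - e s) (e s).
    by eapply is_derive_eq; [rewrite /e; derive_rules|rewrite /e; ring].
  have intE : (\int[lebesgue]_(s in `[A, +oo[) (e s)%:E = (0 : R)%:E - (- e A)%:E)%E.
    apply: (@ge0_continuous_FTC2y _ e (fun s => - e s)).
    - by move=> s _; rewrite mulr_ge0 ?powR_ge0 ?expR_ge0.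
    - exact: continuous_subspaceT.
    - rewrite -oppr0; apply: cvgN; rewrite -[X in _ --> X](mulr0 (A `^ (mu - 1))).
      by apply: cvgM; [exact: cvg_cst|exact: cvgr_expR].
    - by move=> s _; have [] := dF s.
    - by apply: cvg_at_right_filter; exact: is_derive_continuous (dF _).
    - by move=> s _; rewrite derive1E; have [_ ->] := dF s.
  apply: (@le_trans _ _ (\int[lebesgue]_(s in `[A, +oo[) (e s)%:E)%E); last first.
    rewrite intE -EFinB lee_fin sub0r opprK /e ler_piMr ?powR_ge0//.
    by rewrite -expR0 ler_expR lerNl oppr0 ltW.
  rewrite integral_itv_obnd_cbnd; last exact: mwE.
  apply: ge0_le_integral => //=.
  - exact: mwE.
  - by apply/measurable_EFinP; apply: measurable_funTS; exact: (continuous_measurable_fun ce).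
  - move=> s; rewrite in_itv/= andbT => As; have s0 := lt_le_trans A0 As.
    rewrite lee_fin /w /e ler_wpM2r ?expR_ge0//.
    rewrite -[in leLHS]opprB -[in leRHS]opprB !powRN lef_pV2 ?posrE ?powR_gt0//.
    by apply: ge0_ler_powR; rewrite ?nnegrE ?subr_ge0 ?(ltW A0) ?(ltW s0).
have tail_ge : (0 <= \int[lebesgue]_(s in `]A, +oo[) (w s)%:E)%E by exact: integral_ge0.
have GE : (\int[lebesgue]_(s in `]0%R, +oo[) (w s)%:E =
    (weighted_primitive (fun s => expR (- s)) 0 mu A)%:E +
    \int[lebesgue]_(s in `]A, +oo[) (w s)%:E)%E.
  rewrite -wpE (@itv_bndbnd_setU _ _ _ (BRight A)) ?bnd_simp//; last exact: ltW.
  rewrite ge0_integral_setU//; first exact: mwE.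
  apply/disj_setPS => s [] /=; rewrite !in_itv/= => /andP[_ sA] /andP[As _].
  by move: sA; rewrite leNgt As.
have -> : Gamma mu = fine (\int[lebesgue]_(s in `]0%R, +oo[) (w s)%:E)%E by [].
rewrite GE; move: tail_le tail_ge.
(* The two bounds exclude the infinite values of the tail. *)
case: (integral _ _ _) => [r| |]//=; rewrite !lee_fin => rA r0.
by rewrite opprD addrA subrr sub0r normrN ger0_norm.
Qed.

(** The substitution [s = r^2] turns the primitive at [A^2] into twice the Gaussian primitive at
    [A]. This tends to [Gamma (1 / 2)], with error at most [A^-1] by [Gamma_tail], while its square
    tends to [pi]. *)
Lemma Gamma_half : Gamma (1 / 2) = Num.sqrt pi :> R.
Proof.
have cg : continuous (@gauss_fun R) by exact: continuous_gauss_fun.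
(* The exponent 1 makes the weight [s^0] constant. *)
pose I : R -> R := weighted_primitive gauss_fun 0 1.
have IE x : I x = gauss_integral_proof.integral0_gauss x.
  by apply: eq_Rintegral => s _; rewrite subrr powRr0 mul1r.
pose W : R -> R := weighted_primitive (fun s => expR (- s)) 0 (1 / 2).
have half0 : 0 < 1 / 2 :> R by lra.
have cI : continuous I by exact: continuous_weighted_primitive.
have cW : continuous W by exact: continuous_weighted_primitive.
have powE (A : R) : 0 < A -> (A * A) `^ (1 / 2 - 1) = A^-1.
  move=> A0; rewrite powRM ?ltW// -powRD; last by rewrite (gt_eqF A0) implybT.
  have -> : 1 / 2 - 1 + (1 / 2 - 1) = -1 :> R by lra.
  by rewrite powR_inv1// ltW.
have WI A : 0 < A -> W (A * A) = 2 * I A.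
  move=> A0; pose f s := W (s * s) - 2 * I s.
  have csq : continuous (fun s : R => s * s) by move=> s; eapply is_derive_continuous; derive_rules.
  have cf : continuous f.
    move=> s; apply: cvgB; first by apply: (continuous_comp (csq s)); exact: cW.
    by apply: cvgM; [exact: cvg_cst|exact: cI].
  have df s : 0 < s -> is_derive s 1 f 0.
    move=> s0; have ss0 : 0 < s * s by rewrite mulr_gt0.
    have dI : is_derive s 1 I _ := is_derive_weighted_primitive gauss_fun 0 _ _ ltr01 cg s0.
    have dW : is_derive (s * s) 1 W _ := is_derive_weighted_primitive _ 0 _ _ half0 cexpN ss0.
    have dsq : is_derive s 1 (fun y : R => y * y) (1 * s + s * 1) by derive_rules.
    have dWsq : is_derive s 1 (fun y => W (y * y)) _ :=
      @is_derive1_comp _ W (fun y => y * y) s _ _ dW dsq.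
    eapply is_derive_eq; first by rewrite /f; derive_rules.
    rewrite !subr0 powE// subrr powRr0 /gauss_fun expr2.
    have -> : s^-1 * expR (- (s * s)) * (1 * s + s * 1) = (s^-1 * s) * (2 * expR (- (s * s))) by ring.
    by rewrite mulVf ?gt_eqF//; ring.
  have : `|f A - f 0| <= 0 - 0.
    apply: (@mean_value_majorant _ f (cst 0) (cst 0) (cst 0) 0 A) => //.
    - exact: ltW.
    - by move=> s s0 _; exact: df.
    - by move=> s s0 _; rewrite normr0.
    - by apply: cvg_at_right_filter; exact: cf.
    - by apply: cvg_at_left_filter; exact: cf.
    - exact: cvg_cst.
    - exact: cvg_cst.
  rewrite subrr normr_le0 subr_eq0 => /eqP.
  have -> : f 0 = 0.
    rewrite /f /W /I [weighted_primitive gauss_fun 0 1 0]weighted_primitive_eq0//.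
    by rewrite weighted_primitive_eq0 ?mulr0 ?subrr.
  by move/eqP; rewrite subr_eq0 => /eqP.
have cvgG : 2 * I x @[x --> +oo] --> (Gamma (1 / 2) : R).
  apply/cvgrPdist_le => e e0; near=> x.
  have x0 : 0 < x by near: x; exact: nbhs_pinfty_gt (num_real _).
  have xe : e^-1 <= x by near: x; exact: nbhs_pinfty_ge (num_real _).
  rewrite distrC -WI//; apply: (le_trans (Gamma_tail _ _ half0 _ _)).
  - by lra.
  - by rewrite mulr_gt0.
  - by rewrite powE// -(invrK e) lef_pV2 ?posrE ?invr_gt0.
have cvgG2 : 4 * (gauss_integral_proof.integral0_gauss x) ^+ 2 @[x --> +oo] --> (Gamma (1 / 2) ^+ 2 : R).
  rewrite expr2 (_ : (fun x => _) = (fun x => (2 * I x) * (2 * I x))).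
    exact: cvgM.
  by apply/funext => x; rewrite -IE; ring.
have cvgP : 4 * (gauss_integral_proof.integral0_gauss x) ^+ 2 @[x --> +oo] --> (4 * (pi / 4) : R).
  by apply: cvgM; [exact: cvg_cst|exact: gauss_integral_proof.cvg_integral0_gauss_sqr].
have := cvg_unique _ cvgG2 cvgP => /(_ _) G2.
have -> : pi = Gamma (1 / 2) ^+ 2 :> R by rewrite G2//; field.
by rewrite sqrtr_sqr ger0_norm// Gamma_ge0.
Unshelve. all: by end_near. Qed.

(* - \int_s^{+oo} r^(mu - 1) cos (r + al) dr *)
Definition osc_tail mu al s : R :=
  weighted_primitive (fun r => cos (r + al)) 0 mu s - Gamma mu * cos (pi * mu / 2 + al).

Lemma osc_tail0 mu al : osc_tail mu al 0 = - (Gamma mu * cos (pi * mu / 2 + al)).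
Proof. by rewrite /osc_tail weighted_primitive_eq0// sub0r. Qed.

Lemma continuous_osc_tail mu al : 0 < mu -> continuous (osc_tail mu al).
Proof.
move=> mu0 s; apply: cvgB; last exact: cvg_cst.
by apply: continuous_weighted_primitive.
Qed.

Lemma is_derive_osc_tail mu al s : 0 < mu -> 0 < s ->
  is_derive s 1 (osc_tail mu al) (s `^ (mu - 1) * cos (s + al)).
Proof.
move=> mu0 s0; have dw := is_derive_weighted_primitive _ 0 _ _ mu0 (ccos al) s0.
by eapply is_derive_eq; [rewrite /osc_tail; derive_rules|rewrite !subr0].
Qed.

(** The sum of the constants of two regimes: [mu^-1 + Gamma mu] for [s <= 1] and [2 + pi / 2] for
    [s > 1]. *)
Definition osc_const mu : R := 2 + pi / 2 + mu^-1 + Gamma mu.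

Lemma osc_const_ge0 mu : 0 < mu -> 0 <= osc_const mu.
Proof.
move=> mu0; rewrite /osc_const !addr_ge0 ?Gamma_ge0 ?invr_ge0 ?divr_ge0 ?pi_ge0//; exact: ltW.
Qed.

(** Up to 1 the tail is bounded and [s^(-k) >= 1]; beyond 1, [jordan_bound] and [Gamma_tail] give
    [s^(mu - 1) <= s^(-k)]. The endpoint uses [k = 1 - mu], the Fresnel integral [k = de - 1/2]. *)
Lemma osc_tail_bound mu al k s : 0 < mu -> mu <= 1 -> 0 <= k -> k <= 1 - mu -> 0 < s ->
  `|osc_tail mu al s| <= osc_const mu * s `^ (- k).
Proof.
move=> mu0 mu1 k0 kmu s0.
have cos1 v : `|cos v : R| <= 1 by rewrite ler_norml cos_geN1 cos_le1.
have [s1|s1] := leP s 1.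
  apply: (@le_trans _ _ (mu^-1 + Gamma mu)); last first.
    apply: (@le_trans _ _ (osc_const mu * 1)).
      by rewrite mulr1 /osc_const lerD2r lerDr addr_ge0// divr_ge0// pi_ge0.
    rewrite ler_wpM2l ?osc_const_ge0// powRN -[leLHS]invr1 lef_pV2 ?posrE ?powR_gt0//.
    by rewrite -[leRHS](powRr0 s) ger_powR// s0 s1.
  apply: (le_trans (ler_normB _ _)); apply: lerD; last first.
    by rewrite normrM ger0_norm ?Gamma_ge0// ler_piMr// Gamma_ge0.
  set X := weighted_primitive _ _ _.
  have cX : continuous X by exact: continuous_weighted_primitive.
  pose B r : R := mu^-1 * (r - 0) `^ mu.
  have dX (r : R) : 0 < r -> is_derive r 1 X ((r - 0) `^ (mu - 1) * cos (r + al)).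
    by move=> r0; exact: is_derive_weighted_primitive.
  have dB (r : R) : 0 < r -> is_derive r 1 B ((r - 0) `^ (mu - 1)).
    move=> r0; have dp := is_derive_powR_subl 0 mu r r0.
    eapply is_derive_eq; first by rewrite /B; derive_rules.
    by rewrite mul0r add0r mulrA mulVf ?gt_eqF// mul1r.
  have XB : `|X s - X 0| <= B s - B 0.
    apply: (@mean_value_majorant _ X _ B _ 0 s (ltW s0)
      (fun r r0 _ => dX r r0) (fun r r0 _ => dB r r0)).
    - by move=> r r0 _; rewrite normrM (ger0_norm (powR_ge0 _ _)) ler_piMr// powR_ge0.
    - by apply: cvg_at_right_filter; exact: cX.
    - by apply: cvg_at_left_filter; exact: cX.
    - by apply: cvgM; [exact: cvg_cst|exact: cvg_powR_subl].
    - by apply: cvg_at_left_filter; exact: is_derive_continuous (dB _ s0).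
  have X0 : X 0 = 0 by exact: weighted_primitive_eq0.
  rewrite X0 subr0 in XB; apply: (le_trans XB).
  rewrite /B subrr powR0 ?gt_eqF// mulr0 !subr0.
  rewrite ler_piMr ?invr_ge0 ?(ltW mu0)// -(powRr0 s) ger_powR ?s0//; exact: ltW.
apply: (@le_trans _ _ (osc_const mu * s `^ (mu - 1))); last first.
  by rewrite ler_wpM2l ?osc_const_ge0// ler_powR ?(ltW s1)//; lra.
have -> : osc_tail mu al s =
  (weighted_primitive (fun r => cos (r + al)) 0 mu s -
    cos (pi * mu / 2 + al) * weighted_primitive (fun s => expR (- s)) 0 mu s) +
  cos (pi * mu / 2 + al) * (weighted_primitive (fun s => expR (- s)) 0 mu s - Gamma mu).
  by rewrite /osc_tail; ring.
apply: (le_trans (ler_normD _ _)).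
apply: (@le_trans _ _ ((1 + pi / 2) * s `^ (mu - 1) + 1 * s `^ (mu - 1))).
  apply: lerD; first exact: jordan_bound.
  by rewrite normrM ler_pM// Gamma_tail.
rewrite -mulrDl ler_wpM2r ?powR_ge0// /osc_const.
have : 0 < mu^-1 by rewrite invr_gt0.
by have := Gamma_ge0 mu; lra.
Qed.

End gamma_tail.

(** * The endpoint *)

Section phase_integrals.
Context {R : realType}.
Implicit Types (f : R -> R) (s r y : R).

Lemma is_derive1_inv f s df : f s != 0 -> is_derive s 1 f df ->
  is_derive s 1 (fun x => (f x)^-1) (- (f s) ^- 2 * df).
Proof. by move=> f0 Df; exact: is_deriveV. Qed.

Lemma powR_split (x r q : R) : 0 < x -> x `^ (r + q) = x `^ r * x `^ q.
Proof. by move=> x0; rewrite powRD// (gt_eqF x0) implybT. Qed.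

Lemma powR_subr1 (x r : R) : 0 < x -> x `^ r = x * x `^ (r - 1).
Proof.
by move=> x0; rewrite -{2}(powRr1 (ltW x0)) -powR_split//; congr (_ `^ _); lra.
Qed.

Lemma ler_powR_neg (x y r : R) : 0 < x -> x <= y -> r <= 0 -> y `^ r <= x `^ r.
Proof.
move=> x0 xy r0; have y0 := lt_le_trans x0 xy.
rewrite -(opprK r) !(powRN _ (- r)) lef_pV2 ?posrE ?powR_gt0//.
by apply: ge0_ler_powR; rewrite ?nnegrE ?oppr_ge0 ?(ltW x0) ?(ltW y0).
Qed.

Context (mu t a be : R) (mu_gt0 : 0 < mu) (mu_lt1 : mu < 1)
  (t_gt0 : 0 < t) (a_gt0 : 0 < a).

Let phase s := t * (2 * a * s - s * s) + be.

Context (J : R -> R) (J0 : J 0 = 0) (cJ : continuous J)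
  (dJ : forall s, 0 < s -> is_derive s 1 J (s `^ (mu - 1) * cos (phase s))).

(** The improper integral of [s^(mu - 1) cos (2 t a s + be)] over the half-line, that is, with the
    phase linearized at [s = 0]. *)
Definition endpoint_term : R :=
  Gamma mu * cos (pi * mu / 2 + be) * (2 * t * a) `^ (- mu).

(** In the variable [sigma = s (2 a - s)], the primitive of [sigma^(mu - 1) cos (t sigma + be)] that
    vanishes at infinity. *)
Let G s := t `^ (- mu) * osc_tail mu be (t * (s * (2 * a - s))).

(* Dividing by [2 * (a - s)], up to the power of [2 * a - s], turns the phase
   [s * (2 * a - s)] into the integration variable. *)
Let n s := (2 * a - s) `^ (1 - mu) * (2 * (a - s))^-1.

Let dn s := - ((1 - mu) * (2 * a - s) `^ (1 - mu - 1)) * (2 * (a - s))^-1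
  + (2 * a - s) `^ (1 - mu) * (2 * (2 * (a - s)) ^- 2).

Let is_derive_n s : s < a -> is_derive s 1 n (dn s).
Proof.
move: (mu_gt0) (mu_lt1) (t_gt0) (a_gt0) => m0 m1 t0 a0.
move=> sa; have s2a : s < 2 * a by lra.
have dp := is_derive_powR_subr (2 * a) (1 - mu) s s2a.
have ns0 : 2 * (a - s) != 0 by rewrite mulf_neq0// subr_eq0 (gt_eqF sa).
have di : is_derive s 1 (fun s => (2 * (a - s))^-1) (- (2 * (a - s)) ^- 2 * -2).
  apply: is_derive1_inv => //.
  by eapply is_derive_eq; [derive_rules|rewrite /=; ring].
by eapply is_derive_eq; [rewrite /n; derive_rules|rewrite /dn; ring].
Qed.

Let is_derive_G s : 0 < s -> s < a ->
  is_derive s 1 G ((s * (2 * a - s)) `^ (mu - 1) * cos (phase s) * (2 * (a - s))).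
Proof.
move: (mu_gt0) (mu_lt1) (t_gt0) (a_gt0) => m0 m1 t0 a0.
move=> s0 sa; pose v s := t * (s * (2 * a - s)).
have w0 : 0 < s * (2 * a - s) by rewrite mulr_gt0//; lra.
have v0 : 0 < v s by rewrite mulr_gt0.
have dv : is_derive s 1 v (t * (2 * (a - s))).
  by eapply is_derive_eq; [rewrite /v; derive_rules|rewrite /=; ring].
have dg := is_derive_osc_tail mu be (v s) mu_gt0 v0.
have dgv : is_derive s 1 (fun s => osc_tail mu be (v s)) _ :=
  @is_derive1_comp _ (osc_tail mu be) v s _ _ dg dv.
eapply is_derive_eq; first by rewrite /G; derive_rules.
rewrite mul0r add0r /v powRM ?(ltW t_gt0) ?(ltW w0)//.
have -> : t * (s * (2 * a - s)) + be = phase s by rewrite /phase; ring.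
have tE : t `^ (- mu) * t `^ (mu - 1) * t = 1.
  rewrite -powR_split// -[X in _ * X](powRr1 (ltW t_gt0)) -powR_split//.
  by rewrite -[RHS](powRr0 t); congr (_ `^ _); lra.
by rewrite -[RHS]mul1r -[X in _ = X * _]tE; ring.
Qed.

(** [osc_tail_bound] with the full decay [k = 1 - mu]; the powers of [t] combine into [t^-1]. *)
Let G_bound s : 0 < s -> s < a ->
  `|G s| <= osc_const mu * t^-1 * (s `^ (mu - 1) * (2 * a - s) `^ (mu - 1)).
Proof.
move: (mu_gt0) (mu_lt1) (t_gt0) (a_gt0) => m0 m1 t0 a0.
move=> s0 sa; have d0 : 0 < 2 * a - s by lra.
have sd0 : 0 < s * (2 * a - s) by rewrite mulr_gt0.
have kmu : 0 <= 1 - mu by rewrite subr_ge0 ltW.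
have := @osc_tail_bound _ mu be (1 - mu) (t * (s * (2 * a - s)))
  mu_gt0 (ltW mu_lt1) kmu (lexx _) (mulr_gt0 t_gt0 sd0).
rewrite opprB /G normrM ger0_norm ?powR_ge0// => /(ler_wpM2l (powR_ge0 t (- mu))).
move=> /le_trans; apply.
rewrite powRM ?(ltW t_gt0) ?(ltW sd0)// powRM ?(ltW s0) ?(ltW d0)//.
have tE : t `^ (- mu) * t `^ (mu - 1) = t^-1.
  rewrite -powR_split// -powR_inv1 ?(ltW t_gt0)//; congr (_ `^ _); lra.
by rewrite -tE le_eqVlt; apply/orP; left; apply/eqP; ring.
Qed.

(** Integration by parts: as [J' = n G'], the function [P = J - n G] has derivative [- n' G], of
    order [t^-1], and [P 0] is [endpoint_term]. The range [y <= a / 2] keeps [n] away from its pole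
    at [a]. *)
Lemma endpoint_bound y : 0 < y -> y <= a / 2 ->
  `|J y - endpoint_term| <= osc_const mu * (1 + mu^-1) * (t * a)^-1 * y `^ (mu - 1).
Proof.
move: (mu_gt0) (mu_lt1) (t_gt0) (a_gt0) => m0 m1 t0 a0.
move=> y0 ya; pose P s := J s - n s * G s.
pose K := osc_const mu * t^-1.
have K0 : 0 <= K by rewrite mulr_ge0 ?osc_const_ge0// invr_ge0 ltW.
have cG : continuous G.
  move=> s; apply: cvgM; first exact: cvg_cst.
  apply: (@continuous_comp _ _ _ (fun s => t * (s * (2 * a - s))) (osc_tail mu be)).
    by eapply is_derive_continuous; derive_rules.
  exact: continuous_osc_tail.
have cP s : s < a -> {for s, continuous P}.
  move=> sa; apply: cvgB; first exact: cJ.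
  by apply: cvgM; [exact: is_derive_continuous (is_derive_n _ sa)|exact: cG].
have dP s : 0 < s -> s < a -> is_derive s 1 P (- (dn s * G s)).
  move=> s0 sa; have d1 := dJ _ s0; have d2 := is_derive_n _ sa.
  have d3 := is_derive_G _ s0 sa.
  have sd0 : 0 < 2 * a - s by lra.
  have as0 : a - s != 0 by rewrite subr_eq0 (gt_eqF sa).
  eapply is_derive_eq; first by rewrite /P; derive_rules.
  have -> : n s * ((s * (2 * a - s)) `^ (mu - 1) * cos (phase s) * (2 * (a - s)))
     = s `^ (mu - 1) * cos (phase s).
    rewrite powRM ?(ltW s0) ?(ltW sd0)// /n.
    have E : (2 * a - s) `^ (1 - mu) * (2 * a - s) `^ (mu - 1) = 1.
      by rewrite -powR_split// -[RHS](powRr0 (2 * a - s)); congr (_ `^ _); lra.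
    have E2 : (2 * (a - s))^-1 * (2 * (a - s)) = 1 by rewrite mulVf ?mulf_neq0.
    transitivity (((2 * a - s) `^ (1 - mu) * (2 * a - s) `^ (mu - 1)) *
      ((2 * (a - s))^-1 * (2 * (a - s))) * (s `^ (mu - 1) * cos (phase s))).
      by ring.
    by rewrite E E2 !mul1r.
  by ring.
have P0 : P 0 = endpoint_term.
  rewrite /P J0 /n /G mul0r mulr0 osc_tail0 !subr0.
  have a20 : 0 < 2 * a by lra.
  have -> : endpoint_term = Gamma mu * cos (pi * mu / 2 + be) * (t `^ (- mu) * (2 * a) `^ (- mu)).
    rewrite /endpoint_term -powRM ?(ltW t_gt0) ?(ltW a20)//.
    by congr (_ * _ `^ _); ring.
  have -> : (2 * a) `^ (1 - mu) = 2 * a * (2 * a) `^ (- mu).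
    by rewrite powR_split// powRr1// ltW.
  have -> : 2 * a * (2 * a) `^ (- mu) / (2 * a) = (2 * a) `^ (- mu).
    by rewrite mulrAC mulfV ?mul1r// gt_eqF.
  by ring.
(* Here [a - s >= a / 2], so [|n'| <= (2 a - s)^(1 - mu) * 2 / a^2], whose power cancels the one in
   [G_bound]; [dB] is what remains. *)
pose B s := K * (2 / a ^+ 2) * mu^-1 * (s - 0) `^ mu.
pose dB s := K * (2 / a ^+ 2) * s `^ (mu - 1).
have dBE s : 0 < s -> is_derive s 1 B (dB s).
  move=> s0; have dp := is_derive_powR_subl 0 mu s s0.
  eapply is_derive_eq; first by rewrite /B; derive_rules.
  rewrite mul0r add0r !subr0 /dB mulrA; congr (_ * _).
  by rewrite -mulrA mulVf ?mulr1// gt_eqF.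
have PB : `|P y - P 0| <= B y - B 0.
  apply: (@mean_value_majorant _ P (fun s => - (dn s * G s)) B dB).
  - exact: ltW.
  - by move=> s s0 sy; apply: dP => //; lra.
  - by move=> s s0 _; exact: dBE.
  - move=> s s0 sy; have sa : s < a by lra.
    have sd0 : 0 < 2 * a - s by lra.
    have e0 : 0 < a - s by lra.
    rewrite normrN normrM.
    have dnE : dn s = (2 * a - s) `^ (- mu) * (2 * (a - s) ^+ 2)^-1 * ((2 * a - s) - (1 - mu) * (a - s)).
      rewrite /dn; have -> : 1 - mu - 1 = - mu by lra.
      have -> : (2 * a - s) `^ (1 - mu) = (2 * a - s) * (2 * a - s) `^ (- mu).
        by rewrite powR_split// powRr1// ltW.
      by field; lra.
    have dn_le : `|dn s| <= (2 * a - s) `^ (1 - mu) * (2 / a ^+ 2).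
      rewrite dnE ger0_norm; last first.
        by rewrite !mulr_ge0 ?powR_ge0 ?invr_ge0//; nra.
      have -> : (2 * a - s) `^ (1 - mu) = (2 * a - s) `^ (- mu) * (2 * a - s).
        by rewrite powR_split// powRr1 ?(ltW sd0)// mulrC.
      rewrite -!mulrA ler_wpM2l ?powR_ge0//.
      apply: (@le_trans _ _ ((2 * (a - s) ^+ 2)^-1 * (2 * a - s))).
        by rewrite ler_wpM2l ?invr_ge0//; nra.
      rewrite mulrC ler_wpM2l ?(ltW sd0)//.
      by rewrite -[leRHS]invrK lef_pV2 ?posrE ?invf_div ?divr_gt0 ?exprn_gt0 ?mulr_gt0//; nra.
    apply: (le_trans (ler_pM _ _ dn_le (G_bound _ s0 sa))) => //.
    have E : (2 * a - s) `^ (1 - mu) * (2 * a - s) `^ (mu - 1) = 1.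
      by rewrite -powR_split// -[RHS](powRr0 (2 * a - s)); congr (_ `^ _); lra.
    rewrite /dB /K le_eqVlt; apply/orP; left; apply/eqP.
    by rewrite -[RHS]mul1r -[X in _ = X * _]E; ring.
  - by apply: cvg_at_right_filter; exact: cP.
  - by apply: cvg_at_left_filter; apply: cP; lra.
  - by apply: cvgM; [exact: cvg_cst|exact: cvg_powR_subl].
  - by apply: cvg_at_left_filter; exact: is_derive_continuous (dBE _ y0).
have -> : J y - endpoint_term = (P y - P 0) + n y * G y by rewrite P0 /P; ring.
apply: (le_trans (ler_normD _ _)).
have ya' : y < a by lra.
have yd0 : 0 < 2 * a - y by lra.
have e0 : 0 < a - y by lra.
have t1 : `|P y - P 0| <= K * a^-1 * mu^-1 * y `^ (mu - 1).
  apply: (le_trans PB); rewrite /B subrr powR0 ?gt_eqF// mulr0 !subr0.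
  (* One factor [y <= a / 2] is split off [y^mu] to turn [2 / a^2] into [a^-1]. *)
  rewrite (powR_subr1 _ mu y0) mulrA ler_wpM2r ?powR_ge0//.
  have -> : K * (2 / a ^+ 2) / mu * y = K / mu * (2 / a ^+ 2 * y) by ring.
  have -> : K / a / mu = K / mu * a^-1 by ring.
  apply: ler_wpM2l; first by rewrite divr_ge0// ltW.
  rewrite mulrAC ler_pdivrMr ?exprn_gt0//.
  by rewrite expr2 mulrA mulVf ?gt_eqF// mul1r; lra.
have t2 : `|n y * G y| <= K * a^-1 * y `^ (mu - 1).
  rewrite normrM.
  have n_le : `|n y| <= (2 * a - y) `^ (1 - mu) * a^-1.
    rewrite ger0_norm; last by rewrite mulr_ge0 ?powR_ge0// invr_ge0; lra.
    by rewrite /n ler_wpM2l ?powR_ge0// lef_pV2 ?posrE//; lra.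
  apply: (le_trans (ler_pM _ _ n_le (G_bound _ y0 ya'))) => //.
  have E : (2 * a - y) `^ (1 - mu) * (2 * a - y) `^ (mu - 1) = 1.
    by rewrite -powR_split// -[RHS](powRr0 (2 * a - y)); congr (_ `^ _); lra.
  rewrite /K le_eqVlt; apply/orP; left; apply/eqP.
  by rewrite -[RHS]mul1r -[X in _ = X * _]E; ring.
apply: (le_trans (lerD t1 t2)); rewrite /K invfM.
by rewrite le_eqVlt; apply/orP; left; apply/eqP; ring.
Qed.

End phase_integrals.

(** * The stationary point *)

Section fresnel.
Context {R : realType}.
Implicit Types (t al de r : R).

(* - \int_r^{+oo} cos (t s^2 + al) ds *)
Definition fresnel_tail t al r : R :=
  t `^ (- (1 / 2)) / 2 * osc_tail (1 / 2) al (t * (r * r)).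

Let half_gt0 : 0 < 1 / 2 :> R. Proof. by rewrite divr_gt0. Qed.

Lemma continuous_fresnel_tail t al : continuous (fresnel_tail t al).
Proof.
move=> r; apply: cvgM; first exact: cvg_cst.
apply: (@continuous_comp _ _ _ (fun r => t * (r * r)) (osc_tail (1 / 2) al)).
  by eapply is_derive_continuous; derive_rules.
exact: continuous_osc_tail.
Qed.

Lemma fresnel_tail0 t al : fresnel_tail t al 0 =
  - (Num.sqrt pi * t `^ (- (1 / 2)) * cos (pi / 4 + al)) / 2.
Proof.
rewrite /fresnel_tail !mulr0 osc_tail0 Gamma_half.
have -> : pi * (1 / 2) / 2 = pi / 4 :> R by field.
by ring.
Qed.

Lemma is_derive_fresnel_tail t al r : 0 < t -> 0 < r ->
  is_derive r 1 (fresnel_tail t al) (cos (t * (r * r) + al)).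
Proof.
move=> t0 r0; pose v s := t * (s * s).
have v0 : 0 < v r by rewrite !mulr_gt0.
have dv : is_derive r 1 v (t * (2 * r)).
  by eapply is_derive_eq; [rewrite /v; derive_rules|rewrite /=; ring].
have dg := is_derive_osc_tail (1 / 2) al (v r) half_gt0 v0.
have dgv : is_derive r 1 (fun s => osc_tail (1 / 2) al (v s)) _ :=
  @is_derive1_comp _ (osc_tail (1 / 2) al) v r _ _ dg dv.
eapply is_derive_eq; first by rewrite /fresnel_tail; derive_rules.
rewrite mul0r add0r /v.
have vE : t `^ (- (1 / 2)) * (t * (r * r)) `^ (1 / 2 - 1) * (t * r) = 1.
  rewrite !powRM ?mulr_ge0 ?(ltW t0) ?(ltW r0)//.
  have -> : 1 / 2 - 1 = - (1 / 2) :> R by lra.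
  transitivity ((t `^ (- (1 / 2)) * t `^ (- (1 / 2)) * t) *
    (r `^ (- (1 / 2)) * r `^ (- (1 / 2)) * r)); first by ring.
  rewrite -!powR_split//.
  have -> : - (1 / 2) + - (1 / 2) = -1 :> R by lra.
  by rewrite !powR_inv1 ?(ltW t0) ?(ltW r0)// !mulVf ?gt_eqF// mulr1.
by rewrite -[RHS]mul1r -[X in _ = X * _]vE; field.
Qed.

(** Interpolates between [t^(-1/2)], at [de = 1/2], and [(t r)^-1], at [de = 1]. For [de < 1] the
    power of [r] is integrable at 0. *)
Lemma fresnel_tail_bound t al de r : 0 < t -> 1 / 2 <= de -> de <= 1 -> 0 < r ->
  `|fresnel_tail t al r| <= osc_const (1 / 2) * t `^ (- de) * r `^ (1 - 2 * de).
Proof.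
move=> t0 de0 de1 r0; have v0 : 0 < t * (r * r) by rewrite !mulr_gt0.
have h1 : 1 / 2 <= 1 :> R by lra.
have h2 : 0 <= de - 1 / 2 by lra.
have h3 : de - 1 / 2 <= 1 - 1 / 2 by lra.
have := @osc_tail_bound _ (1 / 2) al (de - 1 / 2) _ half_gt0 h1 h2 h3 v0.
rewrite /fresnel_tail normrM ger0_norm ?divr_ge0 ?powR_ge0//.
have t20 : 0 <= t `^ (- (1 / 2)) / 2 by rewrite divr_ge0 ?powR_ge0.
move=> /(ler_wpM2l t20) /le_trans; apply.
rewrite !powRM ?mulr_ge0 ?(ltW t0) ?(ltW r0)//.
have -> : t `^ (- de) = t `^ (- (1 / 2)) * t `^ (- (de - 1 / 2)).
  by rewrite -powR_split//; congr (_ `^ _); lra.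
have -> : r `^ (1 - 2 * de) = r `^ (- (de - 1 / 2)) * r `^ (- (de - 1 / 2)).
  by rewrite -powR_split//; congr (_ `^ _); lra.
set u := t `^ _; set v := t `^ _; set w := r `^ _; set c := osc_const _.
have -> : u / 2 * (c * (v * (w * w))) = 2^-1 * (c * (u * v) * (w * w)) by ring.
rewrite ler_piMl//; last by lra.
by rewrite !mulr_ge0 ?powR_ge0 ?osc_const_ge0.
Qed.

End fresnel.

Section stationary_phase.
Context {R : realType}.
Context (mu t a be : R) (mu_gt0 : 0 < mu) (mu_lt1 : mu < 1)
  (t_gt0 : 0 < t) (a_gt0 : 0 < a).
Implicit Types (r s y de : R).

Let phase s := t * (2 * a * s - s * s) + be.
(** Completing the square, [phase s = t a^2 + be - t (a - s)^2]; since the cosine is even, the sign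
    can be reversed to reach the form [t r^2 + al] of [fresnel_tail]. *)
Let al := - (t * (a * a) + be).

Context (J : R -> R) (cJ : continuous J)
  (dJ : forall s, 0 < s -> is_derive s 1 J (s `^ (mu - 1) * cos (phase s))).

Let cos_phase s : cos (t * ((a - s) * (a - s)) + al) = cos (phase s).
Proof. by rewrite -cosN; congr cos; rewrite /al /phase; ring. Qed.

(** The correction cancels the oscillating derivative of [J] and leaves only the derivative of the
    amplitude, [(mu - 1) s^(mu - 2)], times a small tail. [right] does the same beyond [a]. *)
Let left s := J s + s `^ (mu - 1) * fresnel_tail t al (a - s).
Let right s := J s - s `^ (mu - 1) * fresnel_tail t al (s - a).

Let continuous_pow s r : 0 < s -> {for s, continuous (fun x => x `^ r)}.
Proof. by move=> s0; exact: is_derive_continuous (is_derive1_powR r s0). Qed.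

Let continuous_left s : 0 < s -> {for s, continuous left}.
Proof.
move=> s0; apply: cvgD; first exact: cJ.
apply: cvgM; first exact: continuous_pow.
apply: (@continuous_comp _ _ _ (fun s => a - s) (fresnel_tail t al)).
  by eapply is_derive_continuous; derive_rules.
exact: continuous_fresnel_tail.
Qed.

Let continuous_right s : 0 < s -> {for s, continuous right}.
Proof.
move=> s0; apply: cvgB; first exact: cJ.
apply: cvgM; first exact: continuous_pow.
apply: (@continuous_comp _ _ _ (fun s => s - a) (fresnel_tail t al)).
  by eapply is_derive_continuous; derive_rules.
exact: continuous_fresnel_tail.
Qed.

Let is_derive_left s : 0 < s -> s < a ->
  is_derive s 1 left ((mu - 1) * s `^ (mu - 2) * fresnel_tail t al (a - s)).
Proof.
move=> s0 sa; have d1 := dJ _ s0; have d2 := is_derive1_powR (mu - 1) s0.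
have as0 : 0 < a - s by rewrite subr_gt0.
have d3 := is_derive_fresnel_tail t al (a - s) t_gt0 as0.
have d4 : is_derive s 1 (fun s => a - s) (-1).
  by eapply is_derive_eq; [derive_rules|rewrite /=; ring].
have d5 : is_derive s 1 (fun s => fresnel_tail t al (a - s)) _ :=
  @is_derive1_comp _ (fresnel_tail t al) (fun s => a - s) s _ _ d3 d4.
eapply is_derive_eq; first by rewrite /left; derive_rules.
rewrite cos_phase; have -> : mu - 1 - 1 = mu - 2 by ring.
by rewrite /=; ring.
Qed.

Let is_derive_right s : a < s ->
  is_derive s 1 right (- ((mu - 1) * s `^ (mu - 2) * fresnel_tail t al (s - a))).
Proof.
move=> sa; have s0 := lt_trans a_gt0 sa.
have d1 := dJ _ s0; have d2 := is_derive1_powR (mu - 1) s0.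
have as0 : 0 < s - a by rewrite subr_gt0.
have d3 := is_derive_fresnel_tail t al (s - a) t_gt0 as0.
have d4 : is_derive s 1 (fun s => s - a) 1.
  by eapply is_derive_eq; [derive_rules|rewrite /=; ring].
have d5 : is_derive s 1 (fun s => fresnel_tail t al (s - a)) _ :=
  @is_derive1_comp _ (fresnel_tail t al) (fun s => s - a) s _ _ d3 d4.
eapply is_derive_eq; first by rewrite /right; derive_rules.
have -> : (s - a) * (s - a) = (a - s) * (a - s) by ring.
rewrite cos_phase; have -> : mu - 1 - 1 = mu - 2 by ring.
by rewrite /=; ring.
Qed.

Context (e L de : R) (e_gt0 : 0 < e) (ea : e <= a) (aL : a <= L)
  (de_gt : 1 / 2 < de) (de_lt1 : de < 1).

(** The product of a bound of [s^(mu - 2)] on [s >= e / 2], the constant of [fresnel_tail_bound],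
    and the integral of [r^(1 - 2 de)] over [[0, L]]. *)
Definition stationary_const : R :=
  (e / 2) `^ (mu - 2) * osc_const (1 / 2) * (L `^ (2 - 2 * de) / (2 - 2 * de)).

Let K := (e / 2) `^ (mu - 2) * osc_const (1 / 2) * t `^ (- de).

Let osc_half_ge0 : 0 <= osc_const (1 / 2) :> R.
Proof. by apply: osc_const_ge0; rewrite divr_gt0. Qed.

Lemma stationary_const_ge0 : 0 <= stationary_const.
Proof.
move: (de_lt1) => d1; have q0 : 0 <= 2 - 2 * de by lra.
by rewrite !mulr_ge0 ?invr_ge0 ?powR_ge0.
Qed.

Let K_ge0 : 0 <= K.
Proof. by rewrite !mulr_ge0 ?powR_ge0. Qed.

Let variation_bound s r : e / 2 <= s -> 0 < r ->
  `|(mu - 1) * s `^ (mu - 2) * fresnel_tail t al r| <= K * r `^ (1 - 2 * de).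
Proof.
move: (mu_gt0) (mu_lt1) (e_gt0) (de_gt) (de_lt1) => m0 m1 e0 d0 d1 es r0.
have e20 : 0 < e / 2 by lra.
rewrite normrM [X in X * _ <= _]normrM.
apply: (@le_trans _ _ (1 * (e / 2) `^ (mu - 2) *
    (osc_const (1 / 2) * t `^ (- de) * r `^ (1 - 2 * de)))); last first.
  by rewrite /K mul1r !mulrA.
apply: ler_pM; rewrite ?mulr_ge0//.
  apply: ler_pM => //; first by rewrite ler_norml; lra.
  by rewrite ger0_norm ?powR_ge0// ler_powR_neg//; lra.
by apply: fresnel_tail_bound => //; exact: ltW.
Qed.

(** The derivative of [left] is at most [K (a - s)^(1 - 2 de)], integrable up to [a]. Starting at
    [a / 2] avoids the singularity of [s^(mu - 2)] at 0. *)
Lemma left_variation y : a / 2 <= y -> y <= a ->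
  `|left y - left (a / 2)| <= stationary_const * t `^ (- de).
Proof.
move: (mu_gt0) (mu_lt1) (e_gt0) (de_gt) (de_lt1) => m0 m1 e0 d0 d1 y1 ya.
move: (ea) (aL) (a_gt0) => ea' aL' a0.
have q0 : 0 < 2 - 2 * de by lra.
pose B s := - (K / (2 - 2 * de) * (a - s) `^ (2 - 2 * de)).
have dB s : s < a -> is_derive s 1 B (K * (a - s) `^ (1 - 2 * de)).
  move=> sa; have dp := is_derive_powR_subr a (2 - 2 * de) s sa.
  eapply is_derive_eq; first by rewrite /B; derive_rules.
  have -> : 2 - 2 * de - 1 = 1 - 2 * de by ring.
  by rewrite /=; field; rewrite gt_eqF.
have y20 : 0 < y by lra.
have a20 : 0 < a / 2 by lra.
(* At [s = a] the slope of [B] is infinite; only the limit from the left is used. *)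
have cB s : s <= a -> B x @[x --> s^'-] --> B s.
  rewrite le_eqVlt => /predU1P[->|sa].
    by apply: cvgN; apply: cvgM; [exact: cvg_cst|exact: cvg_powR_subr].
  by apply: cvg_at_left_filter; exact: is_derive_continuous (dB _ sa).
apply: (@le_trans _ _ (B y - B (a / 2))).
  apply: (@mean_value_majorant _ left
    (fun s => (mu - 1) * s `^ (mu - 2) * fresnel_tail t al (a - s)) B
    (fun s => K * (a - s) `^ (1 - 2 * de)) (a / 2) y y1).
  - by move=> s s1 s2; apply: is_derive_left; lra.
  - by move=> s s1 s2; apply: dB; lra.
  - by move=> s s1 s2; apply: variation_bound; lra.
  - by apply: cvg_at_right_filter; exact: continuous_left.
  - by apply: cvg_at_left_filter; exact: continuous_left.
  - by apply: cvg_at_right_filter; apply: (is_derive_continuous _ _ _ (dB _ _)); lra.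
  - exact: cB.
apply: (@le_trans _ _ (- B (a / 2))).
  by rewrite gerDr /B oppr_le0 mulr_ge0 ?powR_ge0// divr_ge0 ?(ltW q0).
rewrite /B opprK /stationary_const.
have -> : (e / 2) `^ (mu - 2) * osc_const (1 / 2) * (L `^ (2 - 2 * de) / (2 - 2 * de)) * t `^ (- de)
   = K / (2 - 2 * de) * L `^ (2 - 2 * de) by rewrite /K; ring.
rewrite ler_wpM2l ?divr_ge0 ?(ltW q0)//.
by apply: ge0_ler_powR; rewrite ?nnegrE; lra.
Qed.

Lemma right_variation y : a <= y -> y <= L ->
  `|right y - right a| <= stationary_const * t `^ (- de).
Proof.
move: (mu_gt0) (mu_lt1) (e_gt0) (de_gt) (de_lt1) => m0 m1 e0 d0 d1 ay yL.
move: (ea) (aL) (a_gt0) => ea' aL' a0.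
have q0 : 0 < 2 - 2 * de by lra.
pose B s := K / (2 - 2 * de) * (s - a) `^ (2 - 2 * de).
have dB s : a < s -> is_derive s 1 B (K * (s - a) `^ (1 - 2 * de)).
  move=> sa; have dp := is_derive_powR_subl a (2 - 2 * de) s sa.
  eapply is_derive_eq; first by rewrite /B; derive_rules.
  have -> : 2 - 2 * de - 1 = 1 - 2 * de by ring.
  by rewrite /=; field; rewrite gt_eqF.
have y0 : 0 < y by lra.
move: (ay); rewrite le_eqVlt => /predU1P[<-|ay'].
  by rewrite subrr normr0 mulr_ge0 ?powR_ge0 ?stationary_const_ge0.
apply: (@le_trans _ _ (B y - B a)).
  apply: (@mean_value_majorant _ right
    (fun s => - ((mu - 1) * s `^ (mu - 2) * fresnel_tail t al (s - a))) B
    (fun s => K * (s - a) `^ (1 - 2 * de)) a y ay).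
  - by move=> s s1 s2; apply: is_derive_right; lra.
  - by move=> s s1 s2; apply: dB; lra.
  - by move=> s s1 s2; rewrite normrN; apply: variation_bound; lra.
  - by apply: cvg_at_right_filter; exact: continuous_right.
  - by apply: cvg_at_left_filter; exact: continuous_right.
  - by apply: cvgM; [exact: cvg_cst|exact: cvg_powR_subl].
  - by apply: cvg_at_left_filter; exact: is_derive_continuous (dB _ ay').
rewrite /B subrr powR0 ?gt_eqF// mulr0 subr0 /stationary_const.
have -> : (e / 2) `^ (mu - 2) * osc_const (1 / 2) * (L `^ (2 - 2 * de) / (2 - 2 * de)) * t `^ (- de)
   = K / (2 - 2 * de) * L `^ (2 - 2 * de) by rewrite /K; ring.
rewrite ler_wpM2l ?divr_ge0 ?(ltW q0)//.
by apply: ge0_ler_powR; rewrite ?nnegrE; lra.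
Qed.

End stationary_phase.

(** * Integration by parts *)

Section asymptotics.
Context {R : realType}.
Context (mu t a be e L de : R) (mu_gt0 : 0 < mu) (mu_lt1 : mu < 1)
  (t_gt0 : 0 < t) (e_gt0 : 0 < e) (ea : e <= a) (aL : a <= L)
  (de_gt : 1 / 2 < de) (de_lt1 : de < 1).
Implicit Types (s y : R).

Let phase s := t * (2 * a * s - s * s) + be.
Let al := - (t * (a * a) + be).
(** One scale for the endpoint error [t^-1] and the stationary error [t^(- de)], whose order depends
    on whether [t < 1]. *)
Let S := t^-1 + t `^ (- de).
Let kterm := endpoint_term mu t a be.

(** The amplitude [a^(mu - 1)] at the stationary point times the Fresnel integral of
    [cos (t a^2 + be - t r^2)] over the whole line. *)
Definition stationary_term : R :=
  Num.sqrt pi * t `^ (- (1 / 2)) * cos (t * (a * a) + be - pi / 4) * a `^ (mu - 1).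

Definition far_const : R := osc_const mu * (1 + mu^-1) / e.
Definition near_const : R := (e / 2) `^ (mu - 1) * osc_const (1 / 2).
(** Its three terms bound [J (a / 2) - kterm], the Fresnel correction at [a / 2], and the variation
    of [left] up to [a]. *)
Definition offset_const : R :=
  far_const * (e / 2) `^ (mu - 1) + near_const * (e / 2) `^ (1 - 2 * de) +
  stationary_const mu e L de.
(** The integrals over lengths at most [L] of the majorants of [J] minus its limit value: one before
    [a / 2], and the same one on each side of [a]. It involves neither [t], [a] nor [be], whence the
    uniformity. *)
Definition remainder_const : R :=
  far_const / mu * L `^ mu +
  2 * ((offset_const + stationary_const mu e L de) * L +
       near_const / (2 - 2 * de) * L `^ (2 - 2 * de)).

Let a_gt0 : 0 < a. Proof. exact: lt_le_trans ea. Qed.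

Let S_ge : t^-1 <= S /\ t `^ (- de) <= S.
Proof. by rewrite /S lerDl lerDr powR_ge0 invr_ge0 ltW. Qed.

Let S_ge0 : 0 <= S.
Proof. by rewrite addr_ge0 ?powR_ge0// invr_ge0 ltW. Qed.

Lemma far_const_ge0 : 0 <= far_const.
Proof.
by rewrite divr_ge0 ?(ltW e_gt0)// mulr_ge0 ?osc_const_ge0// addr_ge0// invr_ge0 ltW.
Qed.

Lemma near_const_ge0 : 0 <= near_const.
Proof.
by apply: mulr_ge0; [exact: powR_ge0|apply: osc_const_ge0; rewrite divr_gt0].
Qed.

Let st_ge0 : 0 <= stationary_const mu e L de.
Proof. exact: stationary_const_ge0. Qed.

Lemma offset_const_ge0 : 0 <= offset_const.
Proof.
by apply: addr_ge0 => //; apply: addr_ge0; apply: mulr_ge0;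
  rewrite ?powR_ge0 ?far_const_ge0 ?near_const_ge0.
Qed.

Context (J : R -> R) (J0 : J 0 = 0) (cJ : continuous J)
  (dJ : forall s, 0 < s -> is_derive s 1 J (s `^ (mu - 1) * cos (phase s))).

Let far_bound y : 0 < y -> y <= a / 2 ->
  `|J y - kterm| <= far_const * S * y `^ (mu - 1).
Proof.
move=> y0 ya; have := endpoint_bound mu t a be mu_gt0 mu_lt1 t_gt0 a_gt0 J J0 cJ dJ y y0 ya.
move=> /le_trans; apply; rewrite ler_wpM2r ?powR_ge0// /far_const -[leRHS]mulrA.
apply: ler_wpM2l.
  by rewrite mulr_ge0 ?osc_const_ge0// addr_ge0// invr_ge0 ltW.
rewrite invfM mulrC; apply: ler_pM.
- by rewrite invr_ge0 ltW.
- by rewrite invr_ge0 ltW.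
- by rewrite lef_pV2.
- by have [] := S_ge.
Qed.

Let left s := J s + s `^ (mu - 1) * fresnel_tail t al (a - s).
Let right s := J s - s `^ (mu - 1) * fresnel_tail t al (s - a).

Let near_factor y s : e / 2 <= y -> 0 < s ->
  `|y `^ (mu - 1) * fresnel_tail t al s| <= S * (near_const * s `^ (1 - 2 * de)).
Proof.
move=> ey s0; move: (e_gt0) (mu_lt1) (de_gt) (de_lt1) => e0 m1 d0 d1.
rewrite normrM ger0_norm ?powR_ge0//.
have e20 : 0 < e / 2 by lra.
have h : y `^ (mu - 1) <= (e / 2) `^ (mu - 1) by apply: ler_powR_neg => //; lra.
apply: (le_trans (ler_pM _ _ h (fresnel_tail_bound t al de s t_gt0 _ _ s0))) => //.
- exact: powR_ge0.
- exact: ltW.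
- exact: ltW.
have osc0 : 0 <= osc_const (1 / 2) :> R by apply: osc_const_ge0; rewrite divr_gt0.
have Sd : 0 <= S - t `^ (- de) by rewrite subr_ge0; have [] := S_ge.
rewrite -subr_ge0 /near_const.
have -> : S * ((e / 2) `^ (mu - 1) * osc_const (1 / 2) * s `^ (1 - 2 * de)) -
   (e / 2) `^ (mu - 1) * (osc_const (1 / 2) * t `^ (- de) * s `^ (1 - 2 * de)) =
  (S - t `^ (- de)) * ((e / 2) `^ (mu - 1) * osc_const (1 / 2) * s `^ (1 - 2 * de)) by ring.
by apply: mulr_ge0 => //; apply: mulr_ge0 (powR_ge0 _ _); apply: mulr_ge0 (powR_ge0 _ _) _.
Qed.

(** The endpoint estimate at [a / 2] is transported up to [a], along which [left] hardly varies. *)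
Let left_near y : a / 2 <= y -> y <= a -> `|left y - kterm| <= S * offset_const.
Proof.
move=> ay ya; move: (e_gt0) (mu_lt1) (de_gt) (de_lt1) (ea) => e0 m1 d0 d1 ea'.
have a0 := a_gt0; have a20 : 0 < a / 2 by lra.
have h1 := left_variation mu t a be mu_gt0 mu_lt1 t_gt0 a_gt0 J cJ dJ e L de e_gt0 ea aL de_gt de_lt1 y ay ya.
have h2 := far_bound _ a20 (lexx _).
have e2a2 : e / 2 <= a / 2 by lra.
have e20 : 0 < e / 2 by lra.
have aa2 : 0 < a - a / 2 by lra.
have h3 := near_factor _ _ e2a2 aa2.
have p1 : (a / 2) `^ (mu - 1) <= (e / 2) `^ (mu - 1) by apply: ler_powR_neg => //; lra.
have p2 : (a - a / 2) `^ (1 - 2 * de) <= (e / 2) `^ (1 - 2 * de) by apply: ler_powR_neg => //; lra.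
have -> : left y - kterm = (left y - left (a / 2)) + (J (a / 2) - kterm) +
    (a / 2) `^ (mu - 1) * fresnel_tail t al (a - a / 2).
  by rewrite {3}/left; ring.
apply: (le_trans (ler_normD _ _)).
apply: (le_trans (lerD (le_trans (ler_normD _ _) (lerD h1 h2)) h3)).
have q1 : stationary_const mu e L de * t `^ (- de) <= S * stationary_const mu e L de.
  by rewrite mulrC ler_wpM2r//; have [] := S_ge.
have q2 : far_const * S * (a / 2) `^ (mu - 1) <= S * (far_const * (e / 2) `^ (mu - 1)).
  by rewrite [far_const * S]mulrC -mulrA ler_wpM2l// ler_wpM2l// far_const_ge0.
have q3 : S * (near_const * (a - a / 2) `^ (1 - 2 * de)) <= S * (near_const * (e / 2) `^ (1 - 2 * de)).
  by rewrite ler_wpM2l// ler_wpM2l// near_const_ge0.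
by rewrite /offset_const; lra.
Qed.

Let near_left_bound y : a / 2 <= y -> y < a ->
  `|J y - kterm| <= S * (offset_const + stationary_const mu e L de + near_const * (a - y) `^ (1 - 2 * de)).
Proof.
move=> ay ya; move: (ea) (e_gt0) => ea' e0.
have ey : e / 2 <= y by lra.
have ya0 : 0 < a - y by rewrite subr_gt0.
have h1 := left_near _ ay (ltW ya).
have h2 := near_factor _ _ ey ya0.
have h3 : 0 <= S * stationary_const mu e L de by rewrite mulr_ge0.
have -> : J y - kterm = (left y - kterm) - y `^ (mu - 1) * fresnel_tail t al (a - y).
  by rewrite /left; ring.
apply: (le_trans (ler_normB _ _)); lra.
Qed.

(** At [a] the corrections are two half-line Fresnel integrals; together they make the one over the
    line. *)
Let jump : right a = left a + stationary_term.
Proof.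
rewrite /right /left subrr fresnel_tail0 /stationary_term.
have -> : cos (pi / 4 + al) = cos (t * (a * a) + be - pi / 4).
  by rewrite -cosN; congr cos; rewrite /al; ring.
by field.
Qed.

Let near_right_bound y : a < y -> y <= L ->
  `|J y - kterm - stationary_term| <=
  S * (offset_const + stationary_const mu e L de + near_const * (y - a) `^ (1 - 2 * de)).
Proof.
move=> ay yL; move: (ea) (e_gt0) (a_gt0) => ea' e0 a0.
have ey : e / 2 <= y by lra.
have ya0 : 0 < y - a by rewrite subr_gt0.
have a2a : a / 2 <= a by lra.
have h1 := left_near _ a2a (lexx _).
have h2 := near_factor _ _ ey ya0.
have h3 := right_variation mu t a be mu_gt0 mu_lt1 t_gt0 a_gt0 J cJ dJ e L de e_gt0 ea aL de_gt de_lt1 y (ltW ay) yL.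
have h4 : stationary_const mu e L de * t `^ (- de) <= S * stationary_const mu e L de.
  by rewrite mulrC ler_wpM2r//; have [] := S_ge.
have -> : J y - kterm - stationary_term = (right y - right a) + (left a - kterm) +
    y `^ (mu - 1) * fresnel_tail t al (y - a).
  by rewrite jump /right; ring.
apply: (le_trans (ler_normD _ _)).
apply: (le_trans (lerD (le_trans (ler_normD _ _) (lerD h3 h1)) h2)).
by lra.
Qed.

Context (f df X : R -> R) (M : R) (M_ge0 : 0 <= M) (cf : continuous f)
  (Df : forall s, 0 < s -> s < L -> is_derive s 1 f (df s))
  (dfM : forall s, 0 < s -> s < L -> `|df s| <= M) (fL : f L = 0)
  (X0 : X 0 = 0) (cX : continuous X)
  (dX : forall s, 0 < s -> s < L ->
    is_derive s 1 X (s `^ (mu - 1) * (cos (phase s) * f s))).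

(* Integration by parts against [J], up to the constant [k]. *)
Let T k s := X s - f s * (J s - k).

Let continuous_T k : continuous (T k).
Proof.
move=> s; apply: cvgB; first exact: cX.
apply: cvgM; first exact: cf.
by apply: cvgB; [exact: cJ|exact: cvg_cst].
Qed.

Let is_derive_T k s : 0 < s -> s < L -> is_derive s 1 (T k) (- (df s * (J s - k))).
Proof.
move=> s0 sL; have d1 := dX _ s0 sL; have d2 := Df _ s0 sL; have d3 := dJ _ s0.
by eapply is_derive_eq; [rewrite /T; derive_rules|rewrite /=; ring].
Qed.

Let T_norm k s c : 0 < s -> s < L -> `|J s - k| <= c -> `|- (df s * (J s - k))| <= M * c.
Proof. by move=> s0 sL Jc; rewrite normrN normrM ler_pM// dfM. Qed.

Let C5 := offset_const + stationary_const mu e L de.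
Let q := 2 - 2 * de.

Let q_gt0 : 0 < q. Proof. by move: (de_lt1); rewrite /q => d1; lra. Qed.

(** [T k] has derivative [- f' (J - k)], so each pointwise bound of [J - k] is integrated through an
    explicit primitive [B]; [T_left] and [T_right] proceed alike. *)
Let T_far : `|T kterm (a / 2) - T kterm 0| <= M * S * (far_const / mu * L `^ mu).
Proof.
move: (a_gt0) (aL) (mu_gt0) => a0 aL' m0; have a20 : 0 < a / 2 by lra.
pose B s := M * (far_const * S / mu * (s - 0) `^ mu).
have dB s : 0 < s -> is_derive s 1 B (M * (far_const * S * s `^ (mu - 1))).
  move=> s0; have dp := is_derive_powR_subl 0 mu s s0.
  eapply is_derive_eq; first by rewrite /B; derive_rules.
  by rewrite !subr0 /=; field; rewrite gt_eqF.
apply: (@le_trans _ _ (B (a / 2) - B 0)).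
  apply: (@mean_value_majorant _ (T kterm) (fun s => - (df s * (J s - kterm))) B
    (fun s => M * (far_const * S * s `^ (mu - 1))) 0 (a / 2) (ltW a20)).
  - by move=> s s0 s1; apply: is_derive_T => //; lra.
  - by move=> s s0 s1; exact: dB.
  - by move=> s s0 s1; apply: T_norm => //; [lra|apply: far_bound => //; exact: ltW].
  - by apply: cvg_at_right_filter; exact: continuous_T.
  - by apply: cvg_at_left_filter; exact: continuous_T.
  - by apply: cvgM; [exact: cvg_cst|apply: cvgM; [exact: cvg_cst|exact: cvg_powR_subl]].
  - by apply: cvg_at_left_filter; exact: is_derive_continuous (dB _ a20).
rewrite /B subrr powR0 ?gt_eqF// !mulr0 !subr0.
have -> : M * S * (far_const / mu * L `^ mu) = M * (far_const * S / mu * L `^ mu) by ring.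
apply: ler_wpM2l => //; apply: ler_wpM2l.
  by rewrite divr_ge0 ?(ltW m0)// mulr_ge0 ?far_const_ge0.
by apply: ge0_ler_powR; rewrite ?nnegrE; lra.
Qed.

Let T_left : `|T kterm a - T kterm (a / 2)| <=
  M * S * (C5 * L + near_const / q * L `^ q).
Proof.
move: (a_gt0) (aL) (q_gt0) => a0 aL' q0; have a20 : 0 < a / 2 by lra.
have a2a : a / 2 <= a by lra.
pose B s := M * (S * (C5 * s - near_const / q * (a - s) `^ q)).
pose dB s := M * (S * (C5 + near_const * (a - s) `^ (1 - 2 * de))).
have BE s : s < a -> is_derive s 1 B (dB s).
  move=> s0; have dp := is_derive_powR_subr a q s s0.
  eapply is_derive_eq; first by rewrite /B; derive_rules.
  have -> : q - 1 = 1 - 2 * de by rewrite /q; ring.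
  by rewrite /dB /=; field; rewrite gt_eqF.
have nq : 0 <= near_const / q by rewrite divr_ge0 ?near_const_ge0 ?ltW.
have c50 : 0 <= C5 by rewrite addr_ge0 ?offset_const_ge0.
apply: (@le_trans _ _ (B a - B (a / 2))).
  apply: (@mean_value_majorant _ (T kterm) (fun s => - (df s * (J s - kterm))) B dB _ _ a2a).
  - by move=> s s0 s1; apply: is_derive_T; lra.
  - by move=> s s0 s1; apply: T_norm; [lra|lra|apply: near_left_bound => //; exact: ltW].
  - by apply: cvg_at_right_filter; exact: continuous_T.
  - by apply: cvg_at_left_filter; exact: continuous_T.
  - by apply: cvg_at_right_filter; apply: (is_derive_continuous _ _ _ (BE _ _)); lra.
  - apply: cvgM; first exact: cvg_cst.
    apply: cvgM; first exact: cvg_cst.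
    apply: cvgB; first by apply: cvg_at_left_filter; apply: cvgM; [exact: cvg_cst|exact: cvg_id].
    by apply: cvgM; [exact: cvg_cst|exact: cvg_powR_subr].
rewrite /B subrr powR0 ?gt_eqF// mulr0 subr0.
have p : (a - a / 2) `^ q <= L `^ q by apply: ge0_ler_powR; rewrite ?nnegrE; lra.
have -> : M * (S * (C5 * a)) - M * (S * (C5 * (a / 2) - near_const / q * (a - a / 2) `^ q)) =
  M * S * (C5 * (a / 2) + near_const / q * (a - a / 2) `^ q) by field; rewrite gt_eqF.
apply: ler_wpM2l; first by rewrite mulr_ge0.
by apply: lerD; apply: ler_wpM2l => //; lra.
Qed.

(** The value that [J] stays close to beyond the stationary point. *)
Let kh := kterm + stationary_term.

Let T_right : `|T kh L - T kh a| <= M * S * (C5 * L + near_const / q * L `^ q).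
Proof.
move: (a_gt0) (aL) (q_gt0) => a0 aL' q0.
pose B s := M * (S * (C5 * s + near_const / q * (s - a) `^ q)).
pose dB s := M * (S * (C5 + near_const * (s - a) `^ (1 - 2 * de))).
have BE s : a < s -> is_derive s 1 B (dB s).
  move=> s0; have dp := is_derive_powR_subl a q s s0.
  eapply is_derive_eq; first by rewrite /B; derive_rules.
  have -> : q - 1 = 1 - 2 * de by rewrite /q; ring.
  by rewrite /dB /=; field; rewrite gt_eqF.
have nq : 0 <= near_const / q by rewrite divr_ge0 ?near_const_ge0 ?ltW.
have c50 : 0 <= C5 by rewrite addr_ge0 ?offset_const_ge0.
(* If [a = L] there is nothing to the right of [a], and [B] has no derivative at [L]. *)
move: (aL); rewrite le_eqVlt => /predU1P[<-|aLlt].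
  rewrite subrr normr0; apply: mulr_ge0; first by rewrite mulr_ge0.
  by apply: addr_ge0; apply: mulr_ge0; rewrite ?powR_ge0// ltW.
apply: (@le_trans _ _ (B L - B a)).
  apply: (@mean_value_majorant _ (T kh) (fun s => - (df s * (J s - kh))) B dB _ _ aL).
  - by move=> s s0 s1; apply: is_derive_T; lra.
  - by move=> s s0 s1; exact: BE.
  - move=> s s0 s1; apply: T_norm => //; first by lra.
    by rewrite /kh opprD addrA; apply: near_right_bound => //; exact: ltW.
  - by apply: cvg_at_right_filter; exact: continuous_T.
  - by apply: cvg_at_left_filter; exact: continuous_T.
  - apply: cvgM; first exact: cvg_cst.
    apply: cvgM; first exact: cvg_cst.
    apply: cvgD; first by apply: cvg_at_right_filter; apply: cvgM; [exact: cvg_cst|exact: cvg_id].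
    by apply: cvgM; [exact: cvg_cst|exact: cvg_powR_subl].
  - by apply: cvg_at_left_filter; exact: is_derive_continuous (BE _ aLlt).
rewrite /B subrr powR0 ?gt_eqF// mulr0 addr0.
have p : (L - a) `^ q <= L `^ q by apply: ge0_ler_powR; rewrite ?nnegrE; lra.
have -> : M * (S * (C5 * L + near_const / q * (L - a) `^ q)) - M * (S * (C5 * a)) =
  M * S * (C5 * (L - a) + near_const / q * (L - a) `^ q) by ring.
apply: ler_wpM2l; first by rewrite mulr_ge0.
by apply: lerD; apply: ler_wpM2l => //; lra.
Qed.

(** Telescoping: [T kh L = X L] since [f L = 0], [T kterm 0 = f 0 * kterm], and changing the
    constant at [a] produces [f a * stationary_term]. *)
Lemma phase_integral_asymptotics :
  `|X L - f 0 * endpoint_term mu t a be - f a * stationary_term| <=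
  M * (t^-1 + t `^ (- de)) * remainder_const.
Proof.
have -> : X L - f 0 * endpoint_term mu t a be - f a * stationary_term =
    (T kh L - T kh a) + (T kterm a - T kterm (a / 2)) + (T kterm (a / 2) - T kterm 0).
  by rewrite /T /kh fL X0 J0 -/kterm; ring.
apply: (le_trans (ler_normD _ _)).
apply: (le_trans (lerD (le_trans (ler_normD _ _) (lerD T_right T_left)) T_far)).
by rewrite -/S /remainder_const -/C5 -/q le_eqVlt; apply/orP; left; apply/eqP; ring.
Qed.

End asymptotics.

(** * Functions of class C^1 on a segment *)

Section clamped.
Context {R : realType}.
Implicit Types (a b x y : R) (f : R -> R).

(** For [a <= b], the projection onto [[a, b]]; composing with it extends a function continuous on
    the segment to the line. *)
Definition clamp a b x : R := Num.min (Num.max a x) b.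

Lemma clamp_itv a b x : a <= b -> clamp a b x \in `[a, b].
Proof.
by move=> ab; rewrite /clamp in_itv/= le_min le_max lexx ab/= ge_min lexx orbT.
Qed.

Lemma clamp_id a b x : a <= x -> x <= b -> clamp a b x = x.
Proof. by move=> ax xb; rewrite /clamp max_r// min_l. Qed.

Lemma continuous_clamp a b : continuous (clamp a b).
Proof.
move=> x; apply: continuous_min; last exact: cvg_cst.
by apply: continuous_max; [exact: cvg_cst|exact: cvg_id].
Qed.

Lemma continuous_segment_bounded a b f : {within `[a, b], continuous f} ->
  exists2 M, 0 <= M & forall x, a <= x -> x <= b -> `|f x| <= M.
Proof.
move=> cf; have [M [_ hM]] := compact_bounded (continuous_compact cf (@segment_compact _ a b)).
exists (`|M| + 1); first by rewrite addr_ge0.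
move=> x ax xb; apply: hM; first by rewrite (le_lt_trans (ler_norm M))// ltrDl.
by exists x => //=; rewrite in_itv/= ax xb.
Qed.

Lemma C1_on_clamp a b f : a < b -> C1_on a b f ->
  exists df : R -> R, [/\ continuous (f \o clamp a b),
    forall x, a < x -> x < b -> is_derive x 1 (f \o clamp a b) (df x),
    exists2 M, 0 <= M & forall x, a < x -> x < b -> `|df x| <= M &
    exists2 M, 0 <= M & forall x, a <= x -> x <= b -> `|f x| <= M].
Proof.
move=> ab [df cdf Df].
(* Caratheodory's form: the difference quotient, completed by its limit, is continuous at [c] within
   the segment. It yields both the continuity of [f] and its derivative inside. *)
pose q c z := if z == c then df c else (z - c)^-1 * (f z - f c).
have fq c z : f z = f c + (z - c) * q c z.
  rewrite /q; case: eqVneq => [->|zc]; first by rewrite subrr mul0r addr0.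
  by rewrite mulrA mulfV ?subr_eq0// mul1r addrC subrK.
have cq c : c \in `[a, b] -> q c z @[z --> within `[a, b] (nbhs c)] --> df c.
  move=> cI U Udf.
  have h : \forall z \near c, z != c -> z \in `[a, b] -> U ((z - c)^-1 * (f z - f c)).
    exact: Df c cI U Udf.
  suff : \forall z \near c, z \in `[a, b] -> U (q c z) by [].
  apply: filterS h => z h zI; rewrite /q; case: eqVneq => [_|zc].
    exact: nbhs_singleton.
  exact: h.
have cfA c : c \in `[a, b] -> f z @[z --> within `[a, b] (nbhs c)] --> f c.
  move=> cI; rewrite [X in X @ _](_ : f = fun z => f c + (z - c) * q c z); last first.
    by apply/funext => z; exact: fq.
  rewrite -[X in _ --> X]addr0 -[X in _ --> _ + X](mul0r (df c)) -[X in X * df c](subrr c).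
  apply: cvgD; first exact: cvg_cst.
  apply: cvgM; last exact: cq.
  apply: cvgB; last exact: cvg_cst.
  by move=> U /= h; apply: filterS h.
have cg : continuous (f \o clamp a b).
  move=> x; have cI := clamp_itv a b x (ltW ab).
  apply: (@cvg_comp _ _ _ (clamp a b) f _ (within `[a, b] (nbhs (clamp a b x)))).
    move=> U h; have h' : \forall z \near clamp a b x, z \in `[a, b] -> U z by exact: h.
    have hx : \forall z \near x, clamp a b z \in `[a, b] -> U (clamp a b z).
      exact: continuous_clamp a b x _ h'.
    suff : \forall z \near x, U (clamp a b z) by [].
    by apply: filterS hx => z; apply; exact: clamp_itv _ _ _ (ltW ab).
  exact: cfA.
exists df; split => //.
- move=> x ax xb; apply: (@near_eq_is_derive _ _ _ f).
    near=> z; rewrite /= clamp_id//; apply: ltW; near: z.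
    + exact: lt_nbhsr.
    + exact: lt_nbhsl.
  apply/is_derive1_caratheodory; exists (q x); split.
  + by move=> z; rewrite [f z](fq x) addrC addKr mulrC.
  + have xI : x \in `[a, b] by rewrite in_itv/= !ltW.
    have qx : q x x = df x by rewrite /q eqxx.
    suff : q x z @[z --> x] --> q x x by [].
    rewrite qx => U Udf.
    have h : \forall z \near x, z \in `[a, b] -> U (q x z) by exact: cq x xI U Udf.
    have h2 : \forall z \near x, z \in `[a, b].
      near=> z; rewrite in_itv/=; apply/andP; split; apply: ltW; near: z.
      * exact: lt_nbhsr.
      * exact: lt_nbhsl.
    by apply: filterS2 h h2 => z; apply.
  + by rewrite /q eqxx.
- have [M M0 hM] := continuous_segment_bounded _ _ _ cdf.
  by exists M => // x ax xb; apply: hM; exact: ltW.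
- have [|M M0 hM] := @continuous_segment_bounded a b (f \o clamp a b).
    exact: continuous_subspaceT.
  by exists M => // x ax xb; have := hM _ ax xb; rewrite /= clamp_id.
Unshelve. all: by end_near. Qed.

End clamped.

(** * Oscillatory integrals with a real amplitude of class C^1 *)

Section oscillatory_integral.
Context {R : realType}.
Implicit Types (a b mu t x al e de : R) (f : R -> R).

Let phase t x al p : R := - (t * p ^+ 2) + x * p + al.

Lemma continuous_cos_phase t x al : continuous (fun p => cos (phase t x al p)).
Proof.
have -> : (fun p => cos (phase t x al p)) = (fun p => cos (- (t * (p * p)) + x * p + al)).
  by apply/funext => p; rewrite /phase expr2.
by move=> p; eapply is_derive_continuous; derive_rules.
Qed.

Definition oscillatory_integral a b mu f t x al : R :=
  weighted_primitive (fun p => cos (phase t x al p) * f (clamp a b p)) a mu b.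

(** [phase_integral_asymptotics] after the shift [p = a + s], with stationary point at distance
    [x / (2 t) - a] and length [b - a]. The constant is fixed before [t], [x] and [al]. *)
Lemma oscillatory_integral_asymptotics a b mu e de f :
  0 < mu -> mu < 1 -> a < b -> 0 < e -> 1 / 2 < de -> de < 1 ->
  C1_on a b f -> f b = 0 ->
  exists2 C, 0 <= C & forall t x al, 0 < t -> a + e < x / (2 * t) -> x / (2 * t) < b ->
    `|oscillatory_integral a b mu f t x al
      - f a * (Gamma mu * cos (pi * mu / 2 + phase t x al a) * (2 * t * (x / (2 * t) - a)) `^ (- mu))
      - f (x / (2 * t)) * (Num.sqrt pi * t `^ (- (1 / 2)) * cos (x ^+ 2 / (4 * t) + al - pi / 4)
          * (x / (2 * t) - a) `^ (mu - 1))|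
    <= C * (t^-1 + t `^ (- de)).
Proof.
move=> mu0 mu1 ab e0 de0 de1 C1f fb.
have [df [cg dg [M M0 dfM] _]] := C1_on_clamp _ _ _ ab C1f.
have ba0 : 0 < b - a by rewrite subr_gt0.
(* The absolute value makes nonnegativity immediate. *)
exists `|M * remainder_const mu e (b - a) de| => //.
move=> t x al t0; set p0 := x / (2 * t) => ep pb.
have ea : e <= p0 - a by rewrite lerBrDl ltW.
have aL : p0 - a <= b - a by rewrite lerD2r ltW.
pose be := phase t x al a.
have phaseE s : t * (2 * (p0 - a) * s - s * s) + be = phase t x al (a + s).
  by rewrite /be /phase /p0; field; rewrite gt_eqF.
pose J s := weighted_primitive (fun p => cos (phase t x al p)) a mu (a + s).
pose X s := weighted_primitive (fun p => cos (phase t x al p) * f (clamp a b p)) a mu (a + s).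
have cc : continuous (fun p => cos (phase t x al p) * f (clamp a b p)).
  by move=> p; apply: cvgM; [exact: continuous_cos_phase|exact: cg].
have dsh (s : R) : is_derive s 1 (fun s => a + s) 1.
  by eapply is_derive_eq; [derive_rules|rewrite add0r].
have csh (F : R -> R) : continuous F -> continuous (fun s => F (a + s)).
  move=> cF s; apply: (@continuous_comp _ _ _ (fun s => a + s) F); last exact: cF.
  exact: is_derive_continuous (dsh s).
have dcomp (F : R -> R) d s : is_derive (a + s) 1 F d -> is_derive s 1 (fun s => F (a + s)) d.
  move=> dF; rewrite -[d]mulr1.
  exact: (@is_derive1_comp _ F (fun s => a + s) s _ _ dF (dsh s)).
have J0 : J 0 = 0 by rewrite /J addr0 weighted_primitive_eq0.
have X0 : X 0 = 0 by rewrite /X addr0 weighted_primitive_eq0.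
have cJ : continuous J.
  by apply: csh; apply: continuous_weighted_primitive => //; exact: continuous_cos_phase.
have cX : continuous X by apply: csh; exact: continuous_weighted_primitive.
have sa s : a + s - a = s by rewrite addrC addKr.
have dJ (s : R) : 0 < s -> is_derive s 1 J (s `^ (mu - 1) * cos (t * (2 * (p0 - a) * s - s * s) + be)).
  move=> s0; rewrite phaseE -{2}(sa s); apply: dcomp.
  by apply: is_derive_weighted_primitive; [done|exact: continuous_cos_phase|rewrite ltrDl].
have dX (s : R) : 0 < s -> s < b - a -> is_derive s 1 X (s `^ (mu - 1) *
    (cos (t * (2 * (p0 - a) * s - s * s) + be) * f (clamp a b (a + s)))).
  move=> s0 _; rewrite phaseE -{2}(sa s); apply: dcomp.
  by apply: is_derive_weighted_primitive; [done|exact: cc|rewrite ltrDl].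
have ab' : a + (b - a) = b by rewrite addrC subrK.
have ap : a + (p0 - a) = p0 by rewrite addrC subrK.
have := @phase_integral_asymptotics R mu t (p0 - a) be e (b - a) de mu0 mu1 t0 e0 ea aL
  de0 de1 J J0 cJ dJ (fun s => f (clamp a b (a + s))) (fun s => df (a + s)) X M M0
  (csh _ cg) _ _ _ X0 cX dX.
rewrite /X ab' ap addr0.
rewrite (clamp_id _ _ a) ?(ltW ab)// (clamp_id _ _ b) ?(ltW ab)//.
have ap0 : a <= p0 by rewrite ltW// (lt_trans _ ep)// ltrDl.
rewrite (clamp_id _ _ p0) ?(ltW pb)// /endpoint_term /stationary_term.
have -> : t * ((p0 - a) * (p0 - a)) + be - pi / 4 = x ^+ 2 / (4 * t) + al - pi / 4.
  by rewrite /be /phase /p0; field; rewrite gt_eqF.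
rewrite -/be => main.
apply: (@le_trans _ _ (M * (t^-1 + t `^ (- de)) * remainder_const mu e (b - a) de)).
  apply: main => //.
  - by move=> s s0 sL; apply: (dcomp (f \o clamp a b)); apply: dg; lra.
  - by move=> s s0 sL; apply: dfM; lra.
rewrite mulrAC ler_wpM2r ?ler_norm// addr_ge0 ?powR_ge0// invr_ge0 ltW//.
Qed.

End oscillatory_integral.

(** * Complex amplitudes *)

Local Open Scope complex_scope.

Section complex_modulus.
Context {R : realType}.
Implicit Types (z w : R[i]) (a b : R).
Notation normc := (@Normc.normc R).

Lemma normc_ge0 z : 0 <= normc z.
Proof. by case: z => a b; exact: sqrtr_ge0. Qed.

Lemma normc_le_sum z : normc z <= `|complex.Re z| + `|complex.Im z|.
Proof.
case: z => a b /=; rewrite -[leRHS]ger0_norm ?addr_ge0// -sqrtr_sqr ler_wsqrtr//.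
rewrite sqrrD !real_normK ?num_real//.
by rewrite addrAC lerDl mulrn_wge0// mulr_ge0.
Qed.

Lemma normc_real a : normc a%:C = `|a|.
Proof. by rewrite /= expr0n/= addr0 sqrtr_sqr. Qed.

Lemma normc_expi a : normc (expi a) = 1.
Proof. by rewrite /= cos2Dsin2 sqrtr1. Qed.

Lemma expiD a b : expi (a + b) = expi a * expi b.
Proof.
apply/eqP; rewrite eq_complex /= cosD sinD eqxx /=.
by apply/eqP; ring.
Qed.

Lemma Re_subB z w v : complex.Re (z - w - v) = complex.Re z - complex.Re w - complex.Re v.
Proof. by case: z; case: w; case: v. Qed.

Lemma Im_subB z w v : complex.Im (z - w - v) = complex.Im z - complex.Im w - complex.Im v.
Proof. by case: z; case: w; case: v. Qed.

End complex_modulus.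

(** * Expansion of the solution in the cone *)

Section solution.
Context {R : realType}.
Context (p1 p2 mu : R) (mu_gt0 : 0 < mu) (mu_lt1 : mu < 1) (p12 : p1 < p2).
Context (u0 : tempered_distribution R) (Fu0 ut : R -> R[i])
  (Hu0 : condition_C p1 p2 mu u0 Fu0 ut).
Notation lebesgue := (@lebesgue_measure R).
Implicit Types (t x al : R).

Let ur p := complex.Re (ut p).
Let ui p := complex.Im (ut p).
Let psi t x p : R := - (t * p ^+ 2) + x * p.

Let ur_C1 : C1_on p1 p2 ur. Proof. by have [] := cC_regular Hu0. Qed.
Let ui_C1 : C1_on p1 p2 ui. Proof. by have [] := cC_regular Hu0. Qed.
Let ur_p2 : ur p2 = 0. Proof. by rewrite /ur (cC_right Hu0). Qed.
Let ui_p2 : ui p2 = 0. Proof. by rewrite /ui (cC_right Hu0). Qed.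

(** The formula for [f] is known only inside the interval, like the factorization of [Fu0]; the
    endpoints have measure zero. *)
Let integral_split (f g1 g2 : R -> R) t x al1 al2 :
  continuous (g1 \o clamp p1 p2) -> continuous (g2 \o clamp p1 p2) ->
  (forall p, p1 < p -> p < p2 -> f p = (p - p1) `^ (mu - 1) *
     (cos (psi t x p + al1) * g1 p + cos (psi t x p + al2) * g2 p)) ->
  Rintegral lebesgue `[p1, p2] f =
  oscillatory_integral p1 p2 mu g1 t x al1 + oscillatory_integral p1 p2 mu g2 t x al2.
Proof.
move=> cg1 cg2 fE.
pose h (g : R -> R) al p := cos (psi t x p + al) * g (clamp p1 p2 p).
have ch g al : continuous (g \o clamp p1 p2) -> continuous (h g al).
  by move=> cg p; apply: cvgM; [exact: continuous_cos_phase|exact: cg].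
have int1 := integrable_weighted (h g1 al1) p1 p2 mu mu_gt0 (ch _ _ cg1).
have int2 := integrable_weighted (h g2 al2) p1 p2 mu mu_gt0 (ch _ _ cg2).
pose k p := (p - p1) `^ (mu - 1) * h g1 al1 p + (p - p1) `^ (mu - 1) * h g2 al2 p.
transitivity (Rintegral lebesgue `[p1, p2] k); last first.
  by rewrite /k RintegralD.
have intk : lebesgue.-integrable `[p1, p2] (EFin \o k) by exact: integrableD int1 int2.
have kf : {in `]p1, p2[, k =1 f}.
  move=> p; rewrite in_itv/= => /andP[pp1 pp2]; rewrite fE// /k /h.
  by rewrite (clamp_id _ _ _ (ltW pp1) (ltW pp2)) mulrDr.
have mk : measurable_fun `]p1, p2[ k.
  apply/measurable_EFinP; apply: (measurable_int lebesgue).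
  by apply: integrableS intk => //; exact: subset_itv_oo_cc.
have mf : measurable_fun `]p1, p2[ f.
  by apply: eq_measurable_fun mk => p; rewrite inE/=; exact: kf.
rewrite /Rintegral; congr fine; apply: eq_integral_itv_bounded => // p pI.
by rewrite kf.
Qed.

(** Sines become cosines shifted by a quarter turn, so that one real estimate with a free [al]
    covers all four integrals. *)
Let solution_parts t x :
  let z := cintegral `[p1, p2] (fun p => Fu0 p * expi (psi t x p)) in
  complex.Re z = oscillatory_integral p1 p2 mu ur t x 0 +
                 oscillatory_integral p1 p2 mu ui t x (pi / 2) /\
  complex.Im z = oscillatory_integral p1 p2 mu ui t x 0 +
                 oscillatory_integral p1 p2 mu ur t x (- (pi / 2)).
Proof.
have [_ [cr _ _ _]] := C1_on_clamp _ _ _ p12 ur_C1.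
have [_ [ci _ _ _]] := C1_on_clamp _ _ _ p12 ui_C1.
split; rewrite /cintegral /=; apply: integral_split => // p pp1 pp2.
- rewrite (cC_factor Hu0)// addr0 cosDpihalf /ur /ui.
  by case: (ut p) => r i; rewrite /expi /=; ring.
- rewrite (cC_factor Hu0)// addr0 cosBpihalf /ur /ui.
  by case: (ut p) => r i; rewrite /expi /=; ring.
Qed.

Context (eps de : R) (eps_gt0 : 0 < eps) (de_gt : 1 / 2 < de) (de_lt1 : de < 1).

(** In the expansion of [2 pi u], the endpoint term is [kappa e^(i xi) ut p1] and the stationary one
    [eta e^(i th) ut (x / (2 t))]. *)
Let xi t x := pi * mu / 2 + psi t x p1.
Let th t x := x ^+ 2 / (4 * t) - pi / 4.
Let kappa t x := Gamma mu * (2 * t * (x / (2 * t) - p1)) `^ (- mu).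
Let eta t x := Num.sqrt pi * t `^ (- (1 / 2)) * (x / (2 * t) - p1) `^ (mu - 1).

Let component_estimate f : C1_on p1 p2 f -> f p2 = 0 ->
  exists2 C, 0 <= C & forall t x al, 0 < t -> p1 + eps < x / (2 * t) -> x / (2 * t) < p2 ->
    `|oscillatory_integral p1 p2 mu f t x al
      - f p1 * kappa t x * cos (xi t x + al)
      - f (x / (2 * t)) * eta t x * cos (th t x + al)| <= C * (t^-1 + t `^ (- de)).
Proof.
move=> C1f fp2; have [C C0 hC] := oscillatory_integral_asymptotics _ _ _ _ _ _
  mu_gt0 mu_lt1 p12 eps_gt0 de_gt de_lt1 C1f fp2.
exists C => // t x al t0 xt1 xt2; apply: le_trans (hC t x al t0 xt1 xt2).
rewrite le_eqVlt; apply/orP; left; apply/eqP; congr (Num.norm (_ - _ - _)).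
  have -> : xi t x + al = pi * mu / 2 + (- (t * p1 ^+ 2) + x * p1 + al).
    by rewrite /xi /psi; ring.
  by rewrite /kappa; ring.
have -> : x ^+ 2 / (4 * t) + al - pi / 4 = th t x + al by rewrite /th; ring.
by rewrite /eta; ring.
Qed.

Let cone_bounds t x : cone (p1 + eps) p2 (t, x) ->
  [/\ 0 < t, p1 + eps < x / (2 * t) & x / (2 * t) < p2].
Proof.
move=> [/= t0]; rewrite -[x / (2 * t)]/(x * (2 * t)^-1) invfM mulrCA mulrC.
by move=> h1 h2; split => //; lra.
Qed.

Let H := Hcoef p1 mu ut.
Let K := Kcoef p1 mu ut.

Let HE t x : H t x * (t `^ (- (1 / 2)))%:C =
  ((2 * pi)^-1)%:C * ((eta t x)%:C * expi (th t x) * ut (x / (2 * t))).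
Proof.
rewrite /H /Hcoef /eta /th [x ^+ 2 / _ - _]addrC expiD.
have sp : (2 * Num.sqrt pi)^-1 = (2 * pi)^-1 * Num.sqrt pi :> R.
  have p0 := pi_gt0 R; have s0 : 0 < Num.sqrt pi :> R by rewrite sqrtr_gt0.
  have {2}-> : pi = Num.sqrt pi ^+ 2 :> R by rewrite sqr_sqrtr// ltW.
  by field; rewrite gt_eqF.
by rewrite sp !rmorphM /=; ring.
Qed.

Let KE t x : 0 < t -> p1 < x / (2 * t) -> K t x * (t `^ (- mu))%:C =
  ((2 * pi)^-1)%:C * ((kappa t x)%:C * expi (xi t x) * ut p1).
Proof.
move=> t0 xt; rewrite /K /Kcoef /kappa.
have -> : expi (xi t x) = expi (pi * mu / 2) * expi (psi t x p1) by rewrite -expiD.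
set a := x / (2 * t) - p1; have a0 : 0 < a by rewrite subr_gt0.
have -> : (2 * t * a) `^ (- mu) = 2 `^ (- mu) * t `^ (- mu) * a `^ (- mu).
  by rewrite !powRM ?mulr_ge0 ?(ltW t0) ?(ltW a0).
have -> : Gamma mu / (2 `^ (mu + 1) * pi) = (2 * pi)^-1 * (Gamma mu * 2 `^ (- mu)).
  have c0 : 0 < 2 `^ mu :> R by exact: powR_gt0.
  rewrite powR_split// powRr1// powRN; move: (@pi R) (pi_gt0 R) => c1 c10.
  by field; rewrite (gt_eqF c0) (gt_eqF c10).
by rewrite /psi !rmorphM /=; ring.
Qed.

Let u := schrodinger_solution p1 p2 Fu0.

(** One expansion with both leading terms serves every [mu]; the real and imaginary parts of the
    error are each a sum of two real component errors. *)
Lemma solution_expansion : exists2 C, 0 <= C & forall t x, cone (p1 + eps) p2 (t, x) ->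
  Normc.normc (u t x - H t x * (t `^ (- (1 / 2)))%:C - K t x * (t `^ (- mu))%:C) <=
  C * (t^-1 + t `^ (- de)).
Proof.
have [Cr Cr0 hr] := component_estimate _ ur_C1 ur_p2.
have [Ci Ci0 hi] := component_estimate _ ui_C1 ui_p2.
exists (2 * (Cr + Ci)); first by rewrite mulr_ge0// addr_ge0.
move=> t x /cone_bounds[t0 xt1 xt2].
have xt : p1 < x / (2 * t) by rewrite (lt_trans _ xt1)// ltrDl.
rewrite HE KE// /u /schrodinger_solution.
set z := cintegral _ _; have [zr zi] := solution_parts t x; rewrite -/z in zr zi.
rewrite -!mulrBr Normc.normcM normc_real.
have pi2 : `|(2 * pi)^-1 : R| <= 1.
  rewrite ger0_norm; last by rewrite invr_ge0 mulr_ge0// pi_ge0.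
  by rewrite invf_le1; [have := pi_ge2 R; lra|have := pi_gt0 R; lra].
set w := z - _ - _.
apply: (@le_trans _ _ (Normc.normc w)).
  by rewrite ler_piMl// normc_ge0.
apply: (le_trans (normc_le_sum w)).
have wr : complex.Re w =
    (oscillatory_integral p1 p2 mu ur t x 0
      - ur p1 * kappa t x * cos (xi t x + 0)
      - ur (x / (2 * t)) * eta t x * cos (th t x + 0)) +
    (oscillatory_integral p1 p2 mu ui t x (pi / 2)
      - ui p1 * kappa t x * cos (xi t x + pi / 2)
      - ui (x / (2 * t)) * eta t x * cos (th t x + pi / 2)).
  rewrite /w Re_subB zr !addr0 !cosDpihalf.
  move: (oscillatory_integral _ _ _ ur _ _ _) (oscillatory_integral _ _ _ ui _ _ _).
  rewrite /ur /ui => o1 o2.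
  by case: (ut p1) => ? ?; case: (ut _) => ? ? /=; ring.
have wi : complex.Im w =
    (oscillatory_integral p1 p2 mu ui t x 0
      - ui p1 * kappa t x * cos (xi t x + 0)
      - ui (x / (2 * t)) * eta t x * cos (th t x + 0)) +
    (oscillatory_integral p1 p2 mu ur t x (- (pi / 2))
      - ur p1 * kappa t x * cos (xi t x + - (pi / 2))
      - ur (x / (2 * t)) * eta t x * cos (th t x + - (pi / 2))).
  rewrite /w Im_subB zi !addr0 !cosBpihalf.
  move: (oscillatory_integral _ _ _ ur _ _ _) (oscillatory_integral _ _ _ ui _ _ _).
  rewrite /ur /ui => o1 o2.
  by case: (ut p1) => ? ?; case: (ut _) => ? ? /=; ring.
have S0 : 0 <= t^-1 + t `^ (- de) by rewrite addr_ge0 ?powR_ge0// invr_ge0 ltW.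
have b1 := lerD (hr t x 0 t0 xt1 xt2) (hi t x (pi / 2) t0 xt1 xt2).
have b2 := lerD (hi t x 0 t0 xt1 xt2) (hr t x (- (pi / 2)) t0 xt1 xt2).
have := lerD (le_trans (ler_normD _ _) b1) (le_trans (ler_normD _ _) b2).
by rewrite -wr -wi; lra.
Qed.

(** In the cone [x / (2 t) - p1 > eps], which bounds its negative power. This allows the term of
    lower order to join the remainder. *)
Lemma Kcoef_bound : exists2 C, 0 <= C & forall t x, cone (p1 + eps) p2 (t, x) ->
  Normc.normc (K t x) <= C.
Proof.
exists (`|Gamma mu / (2 `^ (mu + 1) * pi)| * Normc.normc (ut p1) * eps `^ (- mu)).
  by rewrite !mulr_ge0 ?normc_ge0 ?powR_ge0.
move=> t x /cone_bounds[_ xt1 _].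
rewrite /K /Kcoef !Normc.normcM !normc_real !normc_expi !mulr1.
rewrite (ger0_norm (powR_ge0 _ _)); apply: ler_wpM2l.
  by rewrite mulr_ge0 ?normc_ge0.
by apply: ler_powR_neg; rewrite ?oppr_le0 ?(ltW mu_gt0)// lerBrDl ltW.
Qed.

Lemma Hcoef_bound : exists2 C, 0 <= C & forall t x, cone (p1 + eps) p2 (t, x) ->
  Normc.normc (H t x) <= C.
Proof.
have [_ [_ _ _ [Mr Mr0 hr]]] := C1_on_clamp _ _ _ p12 ur_C1.
have [_ [_ _ _ [Mi Mi0 hi]]] := C1_on_clamp _ _ _ p12 ui_C1.
exists (`|(2 * Num.sqrt pi)^-1| * (Mr + Mi) * eps `^ (mu - 1)).
  by rewrite !mulr_ge0 ?addr_ge0 ?powR_ge0.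
move=> t x /cone_bounds[_ xt1 xt2].
have xt : p1 <= x / (2 * t) by rewrite (le_trans _ (ltW xt1))// lerDl ltW.
rewrite /H /Hcoef !Normc.normcM !normc_real !normc_expi !mulr1.
rewrite (ger0_norm (powR_ge0 _ _)); apply: ler_pM.
- by rewrite mulr_ge0 ?normc_ge0.
- exact: powR_ge0.
- apply: ler_wpM2l => //; apply: (le_trans (normc_le_sum _)).
  by apply: lerD; [apply: hr|apply: hi] => //; exact: ltW.
- by apply: ler_powR_neg; rewrite ?subr_le0 ?(ltW mu_lt1)// lerBrDl ltW.
Qed.

End solution.

(** * Finite sums of powers and their exponents *)

Section remainders.
Context {R : realType}.

Lemma remainderE n (C : 'I_n -> R) (beta : n.-tuple R) (c : n.-tuple R) t :
  C =1 tnth c -> remainder C beta t = \sum_(k < n) c`_k * t `^ (- beta`_k).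
Proof.
by move=> CE; apply: eq_bigr => k _; rewrite CE !(tnth_nth 0).
Qed.

Lemma max_neg_lt n (beta : n.+1.-tuple R) z :
  all (fun b => - b < z) beta -> max_neg beta < z.
Proof.
move=> /all_tnthP betaP; rewrite /max_neg; elim/big_ind: _ => //.
by move=> v w vz wz; rewrite gt_max vz wz.
Qed.

End remainders.

Theorem theorem4p2 (R : realType) (mu p1 p2 : R)
    (mu_gt0 : 0 < mu) (mu_lt1 : mu < 1) (p12 : p1 < p2)
    (u0 : tempered_distribution R) (Fu0 ut : R -> R[i])
    (Hu0 : condition_C p1 p2 mu u0 Fu0 ut)
    (eps : R) (eps_gt0 : 0 < eps) (eps_lt : p1 + eps < p2)
    (delta : R) (delta_gt : 1 / 2 < delta) (delta_lt1 : delta < 1) :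
  let u := schrodinger_solution p1 p2 Fu0 in
  let H := Hcoef p1 mu ut in
  let K := Kcoef p1 mu ut in
  exists (C1 : 'I_9 -> R) (C2 : 'I_8 -> R) (C3 : 'I_9 -> R),
    [/\ (forall k, 0 <= C1 k), (forall k, 0 <= C2 k), (forall k, 0 <= C3 k) &
     [/\ (1 / 2 < mu ->
            (forall t x : R, cone (p1 + eps) p2 (t, x) ->
              Normc.normc (u t x - H t x * (t `^ (- (1 / 2)))%:C)
                <= remainder C1 (beta1 mu delta) t) /\
            max_neg (beta1 mu delta) < - (1 / 2)),
         (mu = 1 / 2 ->
            (forall t x : R, cone (p1 + eps) p2 (t, x) ->
              Normc.normc (u t x - (H t x + K t x) * (t `^ (- (1 / 2)))%:C)
                <= remainder C2 (beta2 delta) t) /\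
            max_neg (beta2 delta) < - (1 / 2)) &
         (mu < 1 / 2 ->
            (forall t x : R, cone (p1 + eps) p2 (t, x) ->
              Normc.normc (u t x - K t x * (t `^ (- mu))%:C)
                <= remainder C3 (beta3 delta) t) /\
            max_neg (beta3 delta) < - mu)]].
Proof.
have [C C_ge0 hC] := solution_expansion p1 p2 mu mu_gt0 mu_lt1 p12 u0 Fu0 ut Hu0
  eps delta eps_gt0 delta_gt delta_lt1.
have [CH CH_ge0 hH] := Hcoef_bound p1 p2 mu mu_lt1 p12 u0 Fu0 ut Hu0 eps eps_gt0.
have [CK CK_ge0 hK] := Kcoef_bound p1 p2 mu mu_gt0 ut eps eps_gt0.
have term_le (z : R[i]) D t r : Normc.normc z <= D ->
    Normc.normc (z * (t `^ r)%:C) <= D * t `^ r.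
  move=> zD; rewrite Normc.normcM normc_real (ger0_norm (powR_ge0 _ _)).
  by rewrite ler_wpM2r ?powR_ge0.
move=> u H K.
(* [C] goes with the first exponent 1 and the first exponent [delta]. The leading entry absorbs the
   discarded term: [K t^(- mu)] for [mu > 1/2], [H t^(- 1/2)] for [mu < 1/2]; at [mu = 1/2] both
   terms are kept. *)
pose c1 := [tuple CK; C; 0; 0; C; 0; 0; 0; 0].
pose c2 := [tuple C; 0; 0; C; 0; 0; 0; 0].
pose c3 := [tuple CH; C; 0; 0; C; 0; 0; 0; 0].
have tnth_ge0 n (c : n.-tuple R) : all (>= 0) c -> forall k, 0 <= tnth c k.
  by move=> /all_tnthP.
exists (tnth c1), (tnth c2), (tnth c3).
have pow1 (t : R) : 0 < t -> t `^ (-1) = t^-1 by move=> t0; rewrite powR_inv1 ?ltW.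
split; [by apply: tnth_ge0; rewrite /= CK_ge0 C_ge0 lexx
       |by apply: tnth_ge0; rewrite /= C_ge0 lexx
       |by apply: tnth_ge0; rewrite /= CH_ge0 C_ge0 lexx|split].
- move=> mu_gt; split; last first.
    by apply: max_neg_lt => /=; rewrite !ltrN2 !andbT; lra.
  move=> t x tx; have t0 : 0 < t by case: tx.
  have -> : u t x - H t x * (t `^ (- (1 / 2)))%:C =
      (u t x - H t x * (t `^ (- (1 / 2)))%:C - K t x * (t `^ (- mu))%:C)
      + K t x * (t `^ (- mu))%:C by rewrite subrK.
  apply: (le_trans (le_normcD _ _)).
  apply: (le_trans (lerD (hC t x tx) (term_le _ _ _ _ (hK t x tx)))).
  rewrite (@remainderE _ _ _ _ c1)// !big_ord_recr big_ord0 /= pow1// !mul0r; lra.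
- move=> mu_half; split; last first.
    by apply: max_neg_lt => /=; rewrite !ltrN2 !andbT; lra.
  move=> t x tx; have t0 : 0 < t by case: tx.
  have -> : u t x - (H t x + K t x) * (t `^ (- (1 / 2)))%:C =
      u t x - H t x * (t `^ (- (1 / 2)))%:C - K t x * (t `^ (- mu))%:C.
    by rewrite -mu_half mulrDl opprD addrA.
  apply: (le_trans (hC t x tx)).
  rewrite (@remainderE _ _ _ _ c2)// !big_ord_recr big_ord0 /= pow1// !mul0r; lra.
- move=> mu_lt; split; last first.
    by apply: max_neg_lt => /=; rewrite !ltrN2 !andbT; lra.
  move=> t x tx; have t0 : 0 < t by case: tx.
  have -> : u t x - K t x * (t `^ (- mu))%:C =
      (u t x - H t x * (t `^ (- (1 / 2)))%:C - K t x * (t `^ (- mu))%:C)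
      + H t x * (t `^ (- (1 / 2)))%:C by rewrite addrAC subrK.
  apply: (le_trans (le_normcD _ _)).
  apply: (le_trans (lerD (hC t x tx) (term_le _ _ _ _ (hH t x tx)))).
  rewrite (@remainderE _ _ _ _ c3)// !big_ord_recr big_ord0 /= pow1// !mul0r; lra.
Qed.
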